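(* Let $\alpha>0$ and $\beta\in\mathbb{R}$ satisfy one of: $\beta<\alpha<1$; or $\beta<1<\alpha$; or $\beta<\alpha=1$. Then the essential norm of the $\beta$-Ces\`aro operator $C_\beta:\mathcal{B}_\alpha^0\to\mathcal{B}_\alpha^0$ is $0$.
   Context: $\mathbb{D}=\{z\in\mathbb{C}:|z|<1\}$. For $\alpha>0$, the $\alpha$-Bloch space $\mathcal{B}_\alpha$ is the space of analytic functions $f$ on $\mathbb{D}$ with $\|f\|_{\mathcal{B}_\alpha}:=\sup_{z\in\mathbb{D}}(1-|z|^2)^\alpha|f'(z)|<\infty$. $\mathcal{B}_\alpha^0=\{f\in\mathcal{B}_\alpha: f(0)=0\}$, normed by $\|\cdot\|_{\mathcal{B}_\alpha}$. For $\beta\in\mathbb{R}$, $C_\beta(f)(z)=\int_0^z \frac{f(w)}{w(1-w)^\beta}\,dw$ (principal branch). The essential norm of a bounded operator $T:X\to Y$ between Banach spaces is $\|T\|_e=\inf\{\|T+K\|: K:X\to Y \text{ compact}\}$, $\|\cdot\|$ the operator norm. *)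

(* Defs.v *)
From Stdlib Require Import Reals.
From Coquelicot Require Import Coquelicot.
Open Scope R_scope.

Definition inD (z : C) : Prop := Cmod z < 1.

Definition cderiv (f : C -> C) (z : C) (l : C) : Prop :=
  @is_derive C_AbsRing C_NormedModule f z l.

Definition analytic_D (f : C -> C) : Prop :=
  forall z, inD z -> exists l, cderiv f z l.

Definition bweight (alpha : R) (z : C) : R := Rpower (1 - Cmod z ^ 2) alpha.

Definition bloch_vals (alpha : R) (f : C -> C) (r : R) : Prop :=
  exists z l, inD z /\ cderiv f z l /\ r = bweight alpha z * Cmod l.

Definition bloch_norm_bar (alpha : R) (f : C -> C) : Rbar :=
  Lub_Rbar (bloch_vals alpha f).

(* its real value (meaningful for f in the Bloch space) *)
Definition bloch_norm (alpha : R) (f : C -> C) : R := real (bloch_norm_bar alpha f).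

Definition in_B0 (alpha : R) (f : C -> C) : Prop :=
  analytic_D f /\ is_finite (bloch_norm_bar alpha f) /\ f 0%C = 0%C.

(* Elements of B_alpha^0 are functions on D: two representatives agreeing on D
   are the same element. *)
Definition eqD (f g : C -> C) : Prop := forall z, inD z -> f z = g z.

(* An operator on B_alpha^0 is represented by a map on functions C -> C;
   only its action on (representatives of) elements of B_alpha^0 matters. *)
Definition op := (C -> C) -> (C -> C).

Definition is_linear_op (alpha : R) (T : op) : Prop :=
  (forall f, in_B0 alpha f -> in_B0 alpha (T f)) /\
  (forall f g, in_B0 alpha f -> in_B0 alpha g -> eqD f g -> eqD (T f) (T g)) /\
  (forall f g, in_B0 alpha f -> in_B0 alpha g ->
     eqD (T (fun z => f z + g z)%C) (fun z => T f z + T g z)%C) /\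
  (forall (c : C) f, in_B0 alpha f ->
     eqD (T (fun z => c * f z)%C) (fun z => c * T f z)%C).

Definition is_bounded_op (alpha : R) (T : op) : Prop :=
  is_linear_op alpha T /\
  exists M : R, forall f, in_B0 alpha f ->
    bloch_norm alpha (T f) <= M * bloch_norm alpha f.

Definition op_norm (alpha : R) (T : op) : Rbar :=
  Lub_Rbar (fun r => exists f, in_B0 alpha f /\ bloch_norm alpha f <= 1 /\
                               r = bloch_norm alpha (T f)).

(* compact operator on B_alpha^0: bounded linear, and the image of the closed
   unit ball is relatively compact, i.e. (metric space) every sequence in the
   unit ball has a subsequence whose images converge in B_alpha^0. *)
Definition is_compact_op (alpha : R) (K : op) : Prop :=
  is_bounded_op alpha K /\
  forall u : nat -> (C -> C),
    (forall n, in_B0 alpha (u n) /\ bloch_norm alpha (u n) <= 1) ->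
    exists (phi : nat -> nat) (g : C -> C),
      (forall n, (phi n < phi (S n))%nat) /\ in_B0 alpha g /\
      is_lim_seq (fun n => bloch_norm alpha (fun z => K (u (phi n)) z - g z)%C) 0.

Definition op_plus (T S : op) : op := fun f z => (T f z + S f z)%C.

Definition ess_norm (alpha : R) (T : op) : Rbar :=
  Glb_Rbar (fun r => exists K, is_compact_op alpha K /\
                               op_norm alpha (op_plus T K) = Finite r).

Definition Arg (u : C) : R :=
  let x := fst u in let y := snd u in
  match Rlt_dec 0 x with
  | left _ => atan (y / x)
  | right _ =>
    match Rlt_dec x 0 with
    | left _ => match Rle_dec 0 y with
                | left _ => atan (y / x) + PI
                | right _ => atan (y / x) - PI
                end
    | right _ => match Rlt_dec 0 y with
                 | left _ => PI / 2
                 | right _ => match Rlt_dec y 0 with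
                              | left _ => - (PI / 2)
                              | right _ => 0
                              end
                 end
    end
  end.

(* principal branch power u^b = exp(b Log u), Log u = ln|u| + i Arg u (u <> 0) *)
Definition Cpow (u : C) (b : R) : C :=
  (exp (b * ln (Cmod u)) * cos (b * Arg u), exp (b * ln (Cmod u)) * sin (b * Arg u)).

(* The beta-Cesaro operator
   C_beta f (z) = int_0^z f(w) / (w (1-w)^beta) dw,
   the integral taken along the segment w = t z, t in [0,1]
   (so dw = z dt); the complex integral is the integral of real and
   imaginary parts. *)
Definition cesaro_integrand (beta : R) (f : C -> C) (z : C) (t : R) : C :=
  (f (RtoC t * z) * z / (RtoC t * z * Cpow (1 - RtoC t * z) beta))%C.

Definition cesaro (beta : R) : op := fun f z =>
  (RInt (fun t => fst (cesaro_integrand beta f z t)) 0 1,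
   RInt (fun t => snd (cesaro_integrand beta f z t)) 0 1).

(* Main.v *)
From Stdlib Require Import Reals Lra Lia List.
From Stdlib Require Import Classical ClassicalEpsilon FunctionalExtensionality.
From Coquelicot Require Import Coquelicot.
Require Import Defs.
Open Scope R_scope.

(** The operator is itself compact, so [K := - cesaro beta] gives essential norm 0.
    Since [(cesaro beta f)'(z) = f(z) / (z (1-z)^beta)], only the size of [f] matters, not
    that of [f']. With [b = max beta 0], the hypotheses leave room for an exponent [s] with
    [max 0 (alpha - 1) < s < alpha - b]. A function of Bloch norm at most 1 is
    [O(|z| (1-|z|)^(-s))], so the weighted derivative of its image is
    [O((1-|z|)^(alpha - b - s))], which tends to 0 at the boundary uniformly on the unit ball.
    On a smaller disc the unit ball is equicontinuous, hence totally bounded for uniform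
    convergence; division by [z] near 0 is controlled by Cauchy's estimate for [f'].
    A diagonal extraction gives a Cauchy subsequence of images. Since the functions are only
    assumed complex differentiable, the formula for the derivative and Cauchy's estimate
    rest on Goursat's subdivision argument, carried out on a parameter rectangle. *)

(** * Complex and real-variable derivatives *)

(** A function of the unit ball is bounded for [alpha < 1], at most logarithmic for [alpha = 1] and
    of power growth for [alpha > 1]. A strictly positive exponent [s] with [alpha <= s + 1] puts all
    three under one power bound; the loss is harmless because the inequalities between [alpha] and
    [beta] are strict. The obstacle is the division by [w] at the origin. Neither continuity of
    derivatives nor a removable singularity theorem is at hand, so the integrand is known only to be
    continuous at 0 and differentiable elsewhere, and its primitive is built under exactly these
    conditions. Goursat's argument is run in parameter space because a truncated triangle and an
    annulus are both images of a rectangle: one theorem then yields the primitive and Cauchy's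
    estimate. Limits of derivatives are handled by a mean value inequality instead of Weierstrass's
    theorem. *)

Lemma Cmod_minus_sym (a b : C) : Cmod (a - b) = Cmod (b - a).
Proof. rewrite <- Cmod_opp. f_equal. ring. Qed.

Lemma Cmod_sub_triangle (a b c : C) : Cmod (a - c) <= Cmod (a - b) + Cmod (b - c).
Proof. replace (a - c)%C with ((a - b) + (b - c))%C by ring. apply Cmod_triangle. Qed.

Lemma Cmod_le_sub (a b : C) : Cmod a <= Cmod b + Cmod (a - b).
Proof. replace a with (b + (a - b))%C at 1 by ring. apply Cmod_triangle. Qed.

Lemma cderiv_eps (f : C -> C) (z l : C) :
  cderiv f z l <->
  forall eps, 0 < eps -> exists del, 0 < del /\
    forall w, Cmod (w - z) < del ->
      Cmod (f w - f z - (w - z) * l) <= eps * Cmod (w - z).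
Proof.
  split.
  - intros [_ H] eps He.
    destruct (H z (fun P h => h) (mkposreal eps He)) as [d Hd].
    exists d; split; [apply cond_pos|]. intros w Hw. exact (Hd w Hw).
  - intros H. split.
    + exact (@is_linear_scal_l C_AbsRing C_NormedModule l).
    + intros x Hx eps.
      assert (x = z) as -> by exact (eq_sym (is_filter_lim_locally_unique _ _ Hx)).
      destruct (H eps (cond_pos eps)) as [d [Hd1 Hd2]].
      exists (mkposreal d Hd1). intros w Hw. exact (Hd2 w Hw).
Qed.

(** The limit clause is the same for both module structures on C. The rules for the identity, for
    products and for the inner function of a composition concern the ring over itself, so
    derivatives pass through this equivalence to use them. *)
Lemma cderiv_field (f : C -> C) (z l : C) :
  cderiv f z l <-> @is_derive C_AbsRing (AbsRing_NormedModule C_AbsRing) f z l.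
Proof.
  split.
  - intros [_ H]. split; [exact (@is_linear_scal_l C_AbsRing (AbsRing_NormedModule C_AbsRing) l)|exact H].
  - intros [_ H]. split; [exact (@is_linear_scal_l C_AbsRing C_NormedModule l)|exact H].
Qed.

(** C is taken as a normed space over the reals, so that theorems on vector-valued functions of a
    real variable apply to curves. *)
Definition rderiv (g : R -> C) (t : R) (l : C) : Prop :=
  @is_derive R_AbsRing C_R_NormedModule g t l.

Lemma rderiv_eps (g : R -> C) (t : R) (l : C) :
  rderiv g t l <->
  forall eps, 0 < eps -> exists del, 0 < del /\
    forall s, Rabs (s - t) < del ->
      Cmod (g s - g t - RtoC (s - t) * l) <= eps * Rabs (s - t).
Proof.
  assert (E : forall s, @norm R_AbsRing C_R_NormedModule
     (minus (minus (g s) (g t)) (scal (s - t) l)) = Cmod (g s - g t - RtoC (s - t) * l)).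
  { intros s. rewrite <- Cmod_norm. f_equal.
    destruct (g s), (g t), l.
    unfold minus, plus, opp, scal; simpl.
    unfold prod_plus, prod_opp, prod_scal; simpl. unfold scal, mult, plus, opp; simpl.
    unfold Cminus, Cplus, Copp, Cmult; simpl. unfold mult; simpl. f_equal; ring. }
  split.
  - intros [_ H] eps He.
    destruct (H t (fun P h => h) (mkposreal eps He)) as [d Hd].
    exists d; split; [apply cond_pos|]. intros w Hw. rewrite <- E. exact (Hd w Hw).
  - intros H. split.
    + exact (@is_linear_scal_l R_AbsRing C_R_NormedModule l).
    + intros x Hx eps.
      assert (x = t) as -> by exact (eq_sym (is_filter_lim_locally_unique _ _ Hx)).
      destruct (H eps (cond_pos eps)) as [d [Hd1 Hd2]].
      exists (mkposreal d Hd1). intros w Hw. specialize (Hd2 w Hw). rewrite <- E in Hd2. exact Hd2.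
Qed.

Lemma cderiv_cont (f : C -> C) (z l : C) : cderiv f z l ->
  forall eps, 0 < eps -> exists del, 0 < del /\
    forall w, Cmod (w - z) < del -> Cmod (f w - f z) < eps.
Proof.
  intros H eps He. apply cderiv_eps with (eps := 1) in H; [|lra].
  destruct H as [d [Hd H]].
  assert (Hl := Cmod_ge_0 l).
  exists (Rmin d (eps / (2 + Cmod l))). split.
  - apply Rmin_pos; auto. apply Rdiv_lt_0_compat; lra.
  - intros w Hw.
    specialize (H w (Rlt_le_trans _ _ _ Hw (Rmin_l _ _))).
    assert (Hw2 := Rlt_le_trans _ _ _ Hw (Rmin_r _ _)).
    apply Rle_lt_trans with ((1 + Cmod l) * Cmod (w - z)).
    + eapply Rle_trans; [apply (Cmod_le_sub _ ((w - z) * l)%C)|].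
      rewrite Cmod_mult. lra.
    + apply (Rmult_lt_compat_l (2 + Cmod l)) in Hw2; [|lra].
      replace ((2 + Cmod l) * (eps / (2 + Cmod l))) with eps in Hw2 by (field; lra).
      assert (Hz := Cmod_ge_0 (w - z)). nra.
Qed.

(** The outer derivative is linear over C and the inner one over R, so the chain rule is done with
    epsilons: the error of [f] along the increment of [g], plus the error of [g] times [l], each
    given half of [eps]. *)
Lemma cderiv_rderiv_comp (f : C -> C) (g : R -> C) (t : R) (l d : C) :
  cderiv f (g t) l -> rderiv g t d -> rderiv (fun s => f (g s)) t (d * l)%C.
Proof.
  intros Hf Hg.
  apply rderiv_eps. intros eps He.
  assert (Hd := Cmod_ge_0 d). assert (Hl := Cmod_ge_0 l).
  assert (He1 : 0 < eps / (2 * (1 + Cmod d))) by (apply Rdiv_lt_0_compat; lra).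
  (* The cap 1 makes [g] Lipschitz at [t] with constant [1 + Cmod d]; the other bound pays for the
     second half of the error. *)
  assert (He2 : 0 < Rmin 1 (eps / (2 * (1 + Cmod l)))).
  { apply Rmin_pos; [lra|]. apply Rdiv_lt_0_compat; lra. }
  destruct (proj1 (cderiv_eps _ _ _) Hf _ He1) as [d1 [Hd1 H1]].
  destruct (proj1 (rderiv_eps _ _ _) Hg _ He2) as [d2 [Hd2 H2]].
  exists (Rmin d2 (d1 / (2 + Cmod d))). split.
  { apply Rmin_pos; auto. apply Rdiv_lt_0_compat; lra. }
  intros s Hs.
  assert (Hs1 := Rlt_le_trans _ _ _ Hs (Rmin_r _ _)).
  specialize (H2 s (Rlt_le_trans _ _ _ Hs (Rmin_l _ _))).
  assert (Ha := Rabs_pos (s - t)).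
  assert (B : Cmod (g s - g t) <= (1 + Cmod d) * Rabs (s - t)).
  { eapply Rle_trans; [apply (Cmod_le_sub _ (RtoC (s - t) * d)%C)|].
    rewrite Cmod_mult, Cmod_R.
    assert (Rmin 1 (eps / (2 * (1 + Cmod l))) * Rabs (s - t) <= 1 * Rabs (s - t)).
    { apply Rmult_le_compat_r; auto. apply Rmin_l. } lra. }
  assert (B1 : Cmod (g s - g t) < d1).
  { eapply Rle_lt_trans; [exact B|].
    apply (Rmult_lt_compat_l (2 + Cmod d)) in Hs1; [|lra].
    replace ((2 + Cmod d) * (d1 / (2 + Cmod d))) with d1 in Hs1 by (field; lra). nra. }
  specialize (H1 _ B1).
  replace (f (g s) - f (g t) - RtoC (s - t) * (d * l))%C
    with ((f (g s) - f (g t) - (g s - g t) * l) + (g s - g t - RtoC (s - t) * d) * l)%C by ring.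
  eapply Rle_trans; [apply Cmod_triangle|]. rewrite Cmod_mult.
  assert (X1 : eps / (2 * (1 + Cmod d)) * Cmod (g s - g t) <= eps / 2 * Rabs (s - t)).
  { apply Rle_trans with (eps / (2 * (1 + Cmod d)) * ((1 + Cmod d) * Rabs (s - t))).
    - apply Rmult_le_compat_l; lra.
    - right. field. lra. }
  assert (X2 : Cmod (g s - g t - RtoC (s - t) * d) * Cmod l <= eps / 2 * Rabs (s - t)).
  { apply Rle_trans with ((eps / (2 * (1 + Cmod l)) * Rabs (s - t)) * Cmod l).
    - apply Rmult_le_compat_r; auto. eapply Rle_trans; [exact H2|].
      apply Rmult_le_compat_r; auto. apply Rmin_r.
    - replace (eps / 2 * Rabs (s - t)) with (eps / (2 * (1 + Cmod l)) * Rabs (s - t) * (1 + Cmod l)) by (field; lra).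
      apply Rmult_le_compat_l; [|lra]. apply Rmult_le_pos; auto.
      apply Rlt_le, Rdiv_lt_0_compat; lra. }
  lra.
Qed.

Lemma rderiv_pair (a b : R -> R) (t da db : R) :
  is_derive a t da -> is_derive b t db -> rderiv (fun s => (a s, b s)) t (da, db).
Proof.
  intros Ha Hb.
  unfold rderiv, is_derive.
  eapply filterdiff_ext_lin.
  - apply (filterdiff_comp_2 (T := AbsRing_NormedModule R_AbsRing) (U := R_NormedModule) (V := R_NormedModule) (W := C_R_NormedModule) a b (fun x y => (x, y) : C) _ _ (fun x y => (x,y):C) Ha Hb).
    apply filterdiff_linear. split.
    + intros [x1 x2] [y1 y2]; reflexivity.
    + intros k [x1 x2]; reflexivity.
    + exists 1; split; [lra|]. intros [x y]. simpl. rewrite Rmult_1_l. apply Rle_refl.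
  - intros y. reflexivity.
Qed.

Lemma rderiv_components (g : R -> C) (t : R) (l : C) : rderiv g t l ->
  is_derive (fun s => fst (g s)) t (fst l) /\ is_derive (fun s => snd (g s)) t (snd l).
Proof.
  intros H. split.
  - apply (is_derive_ext (fun s => (fun p : C_R_NormedModule => fst p : R) (g s))); [reflexivity|].
    eapply filterdiff_ext_lin.
    + apply (filterdiff_comp (K := R_AbsRing) (V := C_R_NormedModule) (W := R_NormedModule) g (fun p => fst p) (fun y => scal y l) (fun p => fst p)); [exact H|].
      apply filterdiff_linear, is_linear_fst.
    + intros y; reflexivity.
  - apply (is_derive_ext (fun s => (fun p : C_R_NormedModule => snd p : R) (g s))); [reflexivity|].
    eapply filterdiff_ext_lin.
    + apply (filterdiff_comp (K := R_AbsRing) (V := C_R_NormedModule) (W := R_NormedModule) g (fun p => snd p) (fun y => scal y l) (fun p => snd p)); [exact H|].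
      apply filterdiff_linear, is_linear_snd.
    + intros y; reflexivity.
Qed.

(** Lagrange's identity. Together with [Cmod_dot_attained] it presents the modulus as a maximum of
    real linear functionals, which lets the real mean value theorem act on complex values. *)
Lemma Cmod_dot_le (c1 c2 : R) (m : C) : c1 ^ 2 + c2 ^ 2 <= 1 ->
  c1 * fst m + c2 * snd m <= Cmod m.
Proof.
  intros H. destruct m as [x y]. unfold Cmod; simpl fst; simpl snd.
  apply Rsqr_incr_0_var; [|apply sqrt_pos].
  unfold Rsqr at 2. rewrite sqrt_sqrt by nra. unfold Rsqr.
  assert (0 <= (c1 * y - c2 * x) ^ 2) by apply pow2_ge_0.
  assert ((c1 ^ 2 + c2 ^ 2) * (x ^ 2 + y ^ 2) <= 1 * (x ^ 2 + y ^ 2)) by (apply Rmult_le_compat_r; nra).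
  nra.
Qed.

Lemma Cmod_dot_attained (m : C) : exists c1 c2,
  c1 ^ 2 + c2 ^ 2 <= 1 /\ c1 * fst m + c2 * snd m = Cmod m.
Proof.
  destruct (Req_dec (Cmod m) 0) as [E|E].
  - exists 0, 0. split; [lra|]. rewrite E. ring.
  - exists (fst m / Cmod m), (snd m / Cmod m).
    assert (H : Cmod m ^ 2 = fst m ^ 2 + snd m ^ 2).
    { apply Cmod2_alt. }
    split.
    + right. field_simplify_eq; auto.
    + field_simplify_eq; auto.
Qed.

(** The projection of [f] on the direction of [f z1 - f z0] is a real function with derivative at
    most [dpsi], so [psi] minus this projection has nonnegative derivative. A general [psi] is kept
    because the growth estimate bounds [f'] by a quantity that varies along the segment. *)
Lemma mean_value_ineq (f : C -> C) (z0 z1 : C) (psi dpsi : R -> R) :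
  (forall t, 0 <= t <= 1 -> is_derive psi t (dpsi t)) ->
  (forall t, 0 <= t <= 1 -> exists l, cderiv f (z0 + RtoC t * (z1 - z0))%C l /\
     Cmod l * Cmod (z1 - z0) <= dpsi t) ->
  Cmod (f z1 - f z0) <= psi 1 - psi 0.
Proof.
  intros Hpsi Hf.
  set (g := fun t => (z0 + RtoC t * (z1 - z0))%C).
  set (dl := fun t => ((z1 - z0) * C_derive f (g t))%C).
  assert (Hg : forall t, rderiv g t (z1 - z0)%C).
  { intros t. apply rderiv_eps. intros eps He. exists 1; split; [lra|]. intros s _.
    unfold g.
    replace (z0 + RtoC s * (z1 - z0) - (z0 + RtoC t * (z1 - z0)) - RtoC (s - t) * (z1 - z0))%C
      with (RtoC 0).
    - rewrite Cmod_0. apply Rmult_le_pos; [lra|apply Rabs_pos].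
    - rewrite RtoC_minus. ring. }
  assert (HF : forall t, 0 <= t <= 1 -> rderiv (fun s => f (g s)) t (dl t) /\ Cmod (dl t) <= dpsi t).
  { intros t Ht. destruct (Hf t Ht) as [l [Hl1 Hl2]]. unfold dl.
    assert (El := is_C_derive_unique _ _ _ Hl1). fold (g t) in El. rewrite El. split.
    - apply cderiv_rderiv_comp; auto.
    - rewrite Cmod_mult. lra. }
  destruct (Cmod_dot_attained (f z1 - f z0)%C) as [c1 [c2 [Hc E]]].
  set (h := fun t => psi t - (c1 * fst (f (g t)) + c2 * snd (f (g t)))).
  set (dh := fun t => dpsi t - (c1 * fst (dl t) + c2 * snd (dl t))).
  assert (Hh : forall t, 0 <= t <= 1 -> is_derive h t (dh t)).
  { intros t Ht. destruct (HF t Ht) as [H1 _]. apply rderiv_components in H1. destruct H1 as [Ha Hb].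
    apply (is_derive_minus (K := R_AbsRing) (V := R_NormedModule)); [apply Hpsi; auto|].
    apply (is_derive_plus (K := R_AbsRing) (V := R_NormedModule)); apply is_derive_scal; assumption. }
  destruct (MVT_gen h 0 1 dh) as [c [Hc1 Hc2]].
  - rewrite Rmin_left, Rmax_right by lra. intros x Hx. apply Hh; lra.
  - rewrite Rmin_left, Rmax_right by lra. intros x Hx.
    apply derivable_continuous_pt. exists (dh x). apply is_derive_Reals, Hh, Hx.
  - rewrite Rmin_left, Rmax_right in Hc1 by lra.
    destruct (HF c Hc1) as [_ B].
    assert (X := Cmod_dot_le c1 c2 (dl c) Hc).
    assert (E1 : g 1 = z1) by (unfold g; ring).
    assert (E0 : g 0 = z0) by (unfold g; ring).
    unfold h, dh in Hc2. rewrite E1, E0 in Hc2.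
    rewrite <- E. simpl in E |- *. lra.
Qed.

Lemma mean_value_bound (f : C -> C) (z0 z1 : C) (M : R) :
  (forall t, 0 <= t <= 1 -> exists l, cderiv f (z0 + RtoC t * (z1 - z0))%C l /\ Cmod l <= M) ->
  Cmod (f z1 - f z0) <= M * Cmod (z1 - z0).
Proof.
  intros H.
  replace (M * Cmod (z1 - z0)) with (1 * (M * Cmod (z1 - z0)) - 0 * (M * Cmod (z1 - z0))) by ring.
  apply (mean_value_ineq f z0 z1 (fun t => t * (M * Cmod (z1 - z0))) (fun _ => M * Cmod (z1 - z0))).
  - intros t _. auto_derive; auto. ring.
  - intros t Ht. destruct (H t Ht) as [l [H1 H2]]. exists l; split; auto.
    apply Rmult_le_compat_r; auto. apply Cmod_ge_0.
Qed.

Lemma rderiv_cont (g : R -> C) (t : R) (l : C) : rderiv g t l ->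
  @continuous R_UniformSpace C_UniformSpace g t.
Proof.
  intros H. apply (ex_derive_continuous (V := C_R_NormedModule) g t). exists l; exact H.
Qed.

Lemma continuous_Cmult (a b : R -> C) (t : R) :
  @continuous R_UniformSpace C_UniformSpace a t ->
  @continuous R_UniformSpace C_UniformSpace b t ->
  @continuous R_UniformSpace C_UniformSpace (fun s => (a s * b s)%C) t.
Proof.
  intros Ha Hb.
  assert (F1 : forall c : R -> C, @continuous R_UniformSpace C_UniformSpace c t ->
     continuous (fun s => fst (c s)) t).
  { intros c Hc. apply (continuous_comp c (fun p : C_UniformSpace => fst p) t Hc). apply continuous_fst. }
  assert (F2 : forall c : R -> C, @continuous R_UniformSpace C_UniformSpace c t ->
     continuous (fun s => snd (c s)) t).
  { intros c Hc. apply (continuous_comp c (fun p : C_UniformSpace => snd p) t Hc). apply continuous_snd. }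
  apply (continuous_comp_2 (fun s => fst (a s) * fst (b s) - snd (a s) * snd (b s))
    (fun s => fst (a s) * snd (b s) + snd (a s) * fst (b s)) (fun x y => (x, y) : C_UniformSpace)).
  - apply (continuous_minus (V := R_NormedModule)); apply (continuous_mult (K := R_AbsRing)); auto.
  - apply (continuous_plus (V := R_NormedModule)); apply (continuous_mult (K := R_AbsRing)); auto.
  - apply (continuous_ext (fun p : R * R => p)); [intros [x y]; reflexivity|]. apply continuous_id.
Qed.

Lemma continuous_C_eps (g : R -> C) (t : R) :
  (forall eps, 0 < eps -> exists del, 0 < del /\ forall s, Rabs (s - t) < del -> Cmod (g s - g t) < eps) ->
  @continuous R_UniformSpace C_UniformSpace g t.
Proof.
  intros H. apply filterlim_locally. intros eps.
  destruct (H eps (cond_pos eps)) as [d [Hd1 Hd2]].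
  exists (mkposreal d Hd1). intros s Hs. specialize (Hd2 s Hs).
  apply C_NormedModule_mixin_compat1. exact Hd2.
Qed.

(** * Cauchy's theorem on a parameter rectangle *)

Lemma nested_intervals (x d : nat -> R) :
  (forall n, 0 <= d n) -> (forall n, x n <= x (S n)) ->
  (forall n, x (S n) + d (S n) <= x n + d n) ->
  exists p, forall n, x n <= p <= x n + d n.
Proof.
  intros Hd Hx Hy.
  assert (Hm : forall n k, x n <= x (n + k)%nat).
  { intros n k. induction k; [rewrite Nat.add_0_r; lra|].
    rewrite Nat.add_succ_r. specialize (Hx (n + k)%nat). lra. }
  assert (Hn : forall n k, x (n + k)%nat + d (n + k)%nat <= x n + d n).
  { intros n k. induction k; [rewrite Nat.add_0_r; lra|].
    rewrite Nat.add_succ_r. specialize (Hy (n + k)%nat). lra. }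
  assert (Hb : forall n m, x m <= x n + d n).
  { intros n m. destruct (Nat.le_ge_cases n m) as [L|L].
    - specialize (Hn n (m - n)%nat). replace (n + (m - n))%nat with m in Hn by lia.
      specialize (Hd m). lra.
    - specialize (Hm m (n - m)%nat). replace (m + (n - m))%nat with n in Hm by lia.
      specialize (Hd n). lra. }
  destruct (completeness (fun r => exists n, r = x n)) as [p [P1 P2]].
  - exists (x 0%nat + d 0%nat). intros r [n ->]. apply Hb.
  - exists (x 0%nat), 0%nat. reflexivity.
  - exists p. intros n. split.
    + apply P1. exists n; reflexivity.
    + apply P2. intros r [m ->]. apply Hb.
Qed.

(* [J x y s] stands for the rectangle [[x, x + s wx] x [y, y + s wy]]. *)
Lemma rectangle_bisection (J : R -> R -> R -> C) (a c wx wy : R) :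
  0 < wx -> 0 < wy ->
  (forall x y s, 0 < s -> a <= x -> x + s * wx <= a + wx -> c <= y -> y + s * wy <= c + wy ->
     J x y s = (J x y (s / 2)%R + J (x + s / 2 * wx)%R y (s / 2)%R
       + J x (y + s / 2 * wy)%R (s / 2)%R + J (x + s / 2 * wx)%R (y + s / 2 * wy)%R (s / 2)%R)%C) ->
  (forall x0 y0, a <= x0 <= a + wx -> c <= y0 <= c + wy -> forall eps, 0 < eps ->
     exists del, 0 < del /\ forall x y s, 0 < s < del ->
       a <= x <= x0 -> x0 <= x + s * wx <= a + wx ->
       c <= y <= y0 -> y0 <= y + s * wy <= c + wy ->
       Cmod (J x y s) <= eps * s ^ 2) ->
  J a c 1 = 0%C.
Proof.
  intros Hwx Hwy Hadd Hloc.
  apply Cmod_eq_0. destruct (Req_dec (Cmod (J a c 1)) 0) as [E|E]; [exact E|exfalso].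
  set (K := Cmod (J a c 1)) in *.
  assert (HK : 0 < K) by (unfold K; pose proof (Cmod_ge_0 (J a c 1)); fold K in H |- *; lra).
  (* The invariant of the bisection: halving the scale divides the required size by 4, like the
     area. *)
  set (big := fun x y s => K * s ^ 2 <= Cmod (J x y s)).
  set (sq := fix sq (n : nat) : R * R := match n with
     | O => (a, c)
     | S n => let x := fst (sq n) in let y := snd (sq n) in let s := (/2) ^ (S n) in
        if Rle_dec (K * s ^ 2) (Cmod (J x y s)) then (x, y) else
        if Rle_dec (K * s ^ 2) (Cmod (J (x + s * wx)%R y s)) then (x + s * wx, y) else
        if Rle_dec (K * s ^ 2) (Cmod (J x (y + s * wy)%R s)) then (x, y + s * wy) else
        (x + s * wx, y + s * wy) end).
  set (x := fun n => fst (sq n)). set (y := fun n => snd (sq n)). set (s := fun n : nat => (/2) ^ n).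
  assert (Hs : forall n, 0 < s n) by (intros n; apply pow_lt; lra).
  assert (HsS : forall n, s n = 2 * s (S n)) by (intros n; unfold s; simpl; lra).
  assert (Hstep : forall n, (x (S n) = x n \/ x (S n) = x n + s (S n) * wx) /\
     (y (S n) = y n \/ y (S n) = y n + s (S n) * wy) /\
     (a <= x n -> x n + s n * wx <= a + wx -> c <= y n -> y n + s n * wy <= c + wy ->
      big (x n) (y n) (s n) -> big (x (S n)) (y (S n)) (s (S n)))).
  { intros n. specialize (Hs (S n)). unfold big, x, y. simpl sq. fold (x n) (y n).
    change ((/2) * (/2) ^ n) with (s (S n)).
    assert (Hh : s n / 2 = s (S n)) by (rewrite HsS; lra).
    specialize (HsS n).
    repeat destruct Rle_dec; simpl fst; simpl snd; (split; [auto|split; [auto|]]); intros; auto.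
    (* The default case, where three quarters have failed the test: were the fourth small too, the
       four moduli would add up to less than [K * s n ^ 2]. *)
    apply Rnot_lt_le; intros Hlt.
    pose proof (Hadd (x n) (y n) (s n)) as HJ. rewrite Hh in HJ.
    rewrite HJ in H3 by lra.
    pose proof (Cmod_triangle (J (x n) (y n) (s (S n)) + J (x n + s (S n) * wx)%R (y n) (s (S n)) + J (x n) (y n + s (S n) * wy)%R (s (S n))) (J (x n + s (S n) * wx)%R (y n + s (S n) * wy)%R (s (S n)))) as T1.
    pose proof (Cmod_triangle (J (x n) (y n) (s (S n)) + J (x n + s (S n) * wx)%R (y n) (s (S n))) (J (x n) (y n + s (S n) * wy)%R (s (S n)))) as T2.
    pose proof (Cmod_triangle (J (x n) (y n) (s (S n))) (J (x n + s (S n) * wx)%R (y n) (s (S n)))) as T3.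
    rewrite HsS in H3. nra. }
  assert (Inv : forall n, (a <= x n /\ x n + s n * wx <= a + wx) /\ (c <= y n /\ y n + s n * wy <= c + wy) /\ big (x n) (y n) (s n)).
  { induction n as [|n IH].
    - unfold x, y, s, big; simpl. fold K. repeat split; lra.
    - destruct (Hstep n) as [Hx [Hy Hb]]. destruct IH as [I1 [I2 I3]].
      specialize (HsS n). specialize (Hs (S n)).
      assert (0 < s (S n) * wx) by (apply Rmult_lt_0_compat; auto).
      assert (0 < s (S n) * wy) by (apply Rmult_lt_0_compat; auto).
      assert (s n * wx = 2 * (s (S n) * wx)) by (rewrite HsS; ring).
      assert (s n * wy = 2 * (s (S n) * wy)) by (rewrite HsS; ring).
      split; [destruct Hx; lra|]. split; [destruct Hy; lra|]. apply Hb; tauto. }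
  destruct (nested_intervals x (fun n => s n * wx)) as [x0 Hx0].
  { intros n. apply Rlt_le, Rmult_lt_0_compat; auto. }
  { intros n. destruct (Hstep n) as [Hx _]. assert (0 < s (S n) * wx) by (apply Rmult_lt_0_compat; auto).
    destruct Hx; lra. }
  { intros n. destruct (Hstep n) as [Hx _]. assert (0 < s (S n) * wx) by (apply Rmult_lt_0_compat; auto).
    rewrite (HsS n). destruct Hx; lra. }
  destruct (nested_intervals y (fun n => s n * wy)) as [y0 Hy0].
  { intros n. apply Rlt_le, Rmult_lt_0_compat; auto. }
  { intros n. destruct (Hstep n) as [_ [Hx _]]. assert (0 < s (S n) * wy) by (apply Rmult_lt_0_compat; auto).
    destruct Hx; lra. }
  { intros n. destruct (Hstep n) as [_ [Hx _]]. assert (0 < s (S n) * wy) by (apply Rmult_lt_0_compat; auto).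
    rewrite (HsS n). destruct Hx; lra. }
  (* Local smallness with [K / 2] contradicts [big] on a late rectangle around the limit point. *)
  destruct (Hloc x0 y0) with (eps := K / 2) as [d [Hd1 Hd2]].
  { destruct (Inv 0%nat) as [I1 _]. specialize (Hx0 0%nat). lra. }
  { destruct (Inv 0%nat) as [_ [I1 _]]. specialize (Hy0 0%nat). lra. }
  { lra. }
  destruct (pow_lt_1_zero (/2)) with (y := d) as [N HN]; [rewrite Rabs_pos_eq; lra|exact Hd1|].
  specialize (HN N (le_n _)). fold (s N) in HN. rewrite Rabs_pos_eq in HN by (apply Rlt_le, Hs).
  destruct (Inv N) as [I1 [I2 I3]]. specialize (Hx0 N). specialize (Hy0 N). specialize (Hs N).
  assert (B : Cmod (J (x N) (y N) (s N)) <= K / 2 * s N ^ 2) by (apply Hd2; lra).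
  unfold big in I3. assert (0 < s N ^ 2) by (apply pow_lt; auto). nra.
Qed.

(** * Complex-valued integrals on real intervals, and Goursat's local estimate *)

Definition CInt (f : R -> C) (a b : R) : C := @RInt C_R_CompleteNormedModule f a b.

Definition contRC (f : R -> C) (t : R) : Prop := @continuous R_UniformSpace C_UniformSpace f t.

Lemma CInt_correct (f : R -> C) (a b : R) : a <= b ->
  (forall t, a <= t <= b -> contRC f t) ->
  @is_RInt C_R_NormedModule f a b (CInt f a b).
Proof.
  intros Hab Hf. apply (@RInt_correct C_R_CompleteNormedModule).
  apply (@ex_RInt_continuous C_R_CompleteNormedModule).
  rewrite Rmin_left, Rmax_right by lra. exact Hf.
Qed.

Lemma CInt_Chasles (f : R -> C) (a b c : R) : a <= b -> b <= c ->
  (forall t, a <= t <= c -> contRC f t) ->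
  CInt f a c = (CInt f a b + CInt f b c)%C.
Proof.
  intros Hab Hbc Hf. apply (@is_RInt_unique C_R_CompleteNormedModule).
  apply (@is_RInt_Chasles C_R_NormedModule f a b c); apply CInt_correct; auto; intros; apply Hf; lra.
Qed.

Lemma CInt_bound (f : R -> C) (l : C) (a b M : R) : a <= b ->
  @is_RInt C_R_NormedModule f a b l ->
  (forall t, a <= t <= b -> Cmod (f t) <= M) ->
  Cmod l <= (b - a) * M.
Proof.
  intros Hab Hf HM. rewrite Cmod_norm.
  apply (norm_RInt_le_const (V := C_R_NormedModule) f a b l M Hab); auto.
  intros x Hx. rewrite <- Cmod_norm. auto.
Qed.

Lemma is_CInt_minus (f g : R -> C) (a b : R) (lf lg : C) :
  @is_RInt C_R_NormedModule f a b lf -> @is_RInt C_R_NormedModule g a b lg ->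
  @is_RInt C_R_NormedModule (fun t => f t - g t)%C a b (lf - lg)%C.
Proof. intros Hf Hg. exact (@is_RInt_minus C_R_NormedModule f g a b lf lg Hf Hg). Qed.

Lemma cderiv_rderiv_cont (f : C -> C) (g : R -> C) (t : R) (l d : C) :
  cderiv f (g t) l -> rderiv g t d -> contRC (fun s => f (g s)) t.
Proof. intros H1 H2. exact (rderiv_cont _ _ _ (cderiv_rderiv_comp f g t l d H1 H2)). Qed.

(** A primitive of the first-order Taylor polynomial at [w0]. Its existence makes the affine part of
    [g] contribute nothing to the integral over a closed path. *)
Lemma cderiv_quadratic (g0 g1 w0 w : C) :
  cderiv (fun v => g0 * v + g1 * ((v - w0) * (v - w0)) / 2)%C w (g0 + (w - w0) * g1)%C.
Proof.
  apply cderiv_eps. intros eps He. pose proof (Cmod_ge_0 g1) as Hg.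
  exists (eps / (1 + Cmod g1)). split; [apply Rdiv_lt_0_compat; lra|]. intros v Hv.
  replace (g0 * v + g1 * ((v - w0) * (v - w0)) / 2 - (g0 * w + g1 * ((w - w0) * (w - w0)) / 2) - (v - w) * (g0 + (w - w0) * g1))%C
    with (g1 * (/2) * (v - w) * (v - w))%C.
  2:{ field. }
  rewrite !Cmod_mult. apply Rmult_le_compat_r; [apply Cmod_ge_0|].
  rewrite Cmod_inv by (intros H; apply RtoC_inj in H; lra).
  rewrite Cmod_R, Rabs_pos_eq by lra.
  apply (Rmult_lt_compat_l (1 + Cmod g1)) in Hv; [|lra].
  replace ((1 + Cmod g1) * (eps / (1 + Cmod g1))) with eps in Hv by (field; lra).
  pose proof (Cmod_ge_0 (v - w)). nra.
Qed.

(** Only the Taylor remainder survives the subtraction of the primitive. On a piece of scale [s],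
    both [b - a] and [rho] are of order [s], so the error is of order [eps * s ^ 2], as the
    bisection requires. *)
Lemma path_integral_near (g : C -> C) (p dp : R -> C) (a b : R) (g0 g1 w0 : C) (eps rho B : R) :
  a <= b -> 0 <= eps -> 
  (forall t, a <= t <= b -> rderiv p t (dp t) /\ contRC dp t /\ Cmod (dp t) <= B /\
     (exists l, cderiv g (p t) l) /\ Cmod (p t - w0) <= rho /\
     Cmod (g (p t) - g0 - (p t - w0) * g1) <= eps * Cmod (p t - w0)) ->
  Cmod (CInt (fun t => g (p t) * dp t)%C a b
    - ((g0 * p b + g1 * ((p b - w0) * (p b - w0)) / 2) - (g0 * p a + g1 * ((p a - w0) * (p a - w0)) / 2)))
  <= (b - a) * (eps * rho * B).
Proof.
  intros Hab Heps H.
  set (P := fun v => (g0 * v + g1 * ((v - w0) * (v - w0)) / 2)%C).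
  assert (Hc : forall t, a <= t <= b -> contRC (fun t => dp t * (g0 + (p t - w0) * g1))%C t).
  { intros t Ht. destruct (H t Ht) as [H1 [H2 _]].
    apply continuous_Cmult; [exact H2|].
    apply (cderiv_rderiv_cont (fun v => g0 + (v - w0) * g1)%C p t g1 (dp t)); [|exact H1].
    apply cderiv_eps. intros e He. exists 1; split; [lra|]. intros w _.
    replace (g0 + (w - w0) * g1 - (g0 + (p t - w0) * g1) - (w - p t) * g1)%C with (RtoC 0) by ring.
    rewrite Cmod_0. apply Rmult_le_pos; [lra|apply Cmod_ge_0]. }
  assert (I1 : @is_RInt C_R_NormedModule (fun t => dp t * (g0 + (p t - w0) * g1))%C a b (P (p b) - P (p a))%C).
  { apply (@is_RInt_derive C_R_CompleteNormedModule (fun t => P (p t))); rewrite Rmin_left, Rmax_right by lra.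
    - intros t Ht. destruct (H t Ht) as [H1 _].
      apply (cderiv_rderiv_comp P p t _ _ (cderiv_quadratic g0 g1 w0 (p t)) H1).
    - exact Hc. }
  assert (I2 : @is_RInt C_R_NormedModule (fun t => g (p t) * dp t)%C a b (CInt (fun t => g (p t) * dp t)%C a b)).
  { apply CInt_correct; auto. intros t Ht. destruct (H t Ht) as [H1 [H2 [_ [[l Hl] _]]]].
    apply continuous_Cmult; [|exact H2]. exact (cderiv_rderiv_cont g p t l _ Hl H1). }
  apply (CInt_bound _ _ a b _ Hab (is_CInt_minus _ _ _ _ _ _ I2 I1)).
  intros t Ht. destruct (H t Ht) as [_ [_ [H3 [_ [H4 H5]]]]].
  replace (g (p t) * dp t - dp t * (g0 + (p t - w0) * g1))%C with ((g (p t) - g0 - (p t - w0) * g1) * dp t)%C by ring.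
  rewrite Cmod_mult. apply Rmult_le_compat; try apply Cmod_ge_0; auto.
  eapply Rle_trans; [exact H5|]. apply Rmult_le_compat_l; auto.
Qed.
Lemma rderiv_lipschitz (p dp : R -> C) (a b B : R) : a <= b ->
  (forall t, a <= t <= b -> rderiv p t (dp t) /\ contRC dp t /\ Cmod (dp t) <= B) ->
  Cmod (p b - p a) <= (b - a) * B.
Proof.
  intros Hab H.
  apply (CInt_bound dp _ a b B Hab); [|intros t Ht; apply H, Ht].
  apply (@is_RInt_derive C_R_CompleteNormedModule p); rewrite Rmin_left, Rmax_right by lra;
    intros t Ht; apply H, Ht.
Qed.

Lemma rderiv_lipschitz_abs (p dp : R -> C) (a b u v B r : R) :
  (forall t, a <= t <= b -> rderiv p t (dp t) /\ contRC dp t /\ Cmod (dp t) <= B) ->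
  a <= u <= b -> a <= v <= b -> 0 <= B -> u - r <= v <= u + r ->
  Cmod (p u - p v) <= r * B.
Proof.
  intros H Hu Hv HB Hr.
  destruct (Rle_dec u v) as [L|L].
  - rewrite Cmod_minus_sym. eapply Rle_trans; [apply (rderiv_lipschitz p dp u v B L)|].
    + intros t Ht. apply H. lra.
    + apply Rmult_le_compat_r; lra.
  - eapply Rle_trans; [apply (rderiv_lipschitz p dp v u B)|].
    + lra.
    + intros t Ht. apply H. lra.
    + apply Rmult_le_compat_r; lra.
Qed.

(* The integral of [g(w) dw] along the image under [Phi] of the boundary of a rectangle. *)
Theorem Cauchy_rectangle (g : C -> C) (Phi Phi1 Phi2 : R -> R -> C) (a c wx wy B : R) :
  0 < wx -> 0 < wy ->
  (forall x y, a <= x <= a + wx -> c <= y <= c + wy ->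
     (rderiv (fun s => Phi s y) x (Phi1 x y) /\ contRC (fun s => Phi1 s y) x /\ Cmod (Phi1 x y) <= B) /\
     (rderiv (fun s => Phi x s) y (Phi2 x y) /\ contRC (fun s => Phi2 x s) y /\ Cmod (Phi2 x y) <= B) /\
     (exists l, cderiv g (Phi x y) l)) ->
  (CInt (fun s => g (Phi s c) * Phi1 s c)%C a (a + wx)
   + CInt (fun s => g (Phi (a + wx)%R s) * Phi2 (a + wx)%R s)%C c (c + wy)
   - CInt (fun s => g (Phi s (c + wy)%R) * Phi1 s (c + wy)%R)%C a (a + wx)
   - CInt (fun s => g (Phi a s) * Phi2 a s)%C c (c + wy) = 0)%C.
Proof.
  intros Hwx Hwy H.
  assert (HB : 0 <= B).
  { destruct (H a c) as [[_ [_ B1]] _]; try lra. eapply Rle_trans; [apply Cmod_ge_0|exact B1]. }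
  set (Hz := fun y u v => CInt (fun s => g (Phi s y) * Phi1 s y)%C u v).
  set (Vt := fun x u v => CInt (fun s => g (Phi x s) * Phi2 x s)%C u v).
  assert (HzC : forall y u m v, c <= y <= c + wy -> a <= u -> u <= m -> m <= v -> v <= a + wx ->
     Hz y u v = (Hz y u m + Hz y m v)%C).
  { intros y u m v Hy Hu Hm Hv Hv2. apply CInt_Chasles; auto. intros t Ht.
    destruct (H t y) as [[H1 [H2 _]] [_ [l Hl]]]; try lra.
    apply continuous_Cmult; [|exact H2].
    exact (cderiv_rderiv_cont g (fun s => Phi s y) t l _ Hl H1). }
  assert (VtC : forall x u m v, a <= x <= a + wx -> c <= u -> u <= m -> m <= v -> v <= c + wy ->
     Vt x u v = (Vt x u m + Vt x m v)%C).
  { intros x u m v Hy Hu Hm Hv Hv2. apply CInt_Chasles; auto. intros t Ht.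
    destruct (H x t) as [_ [[H1 [H2 _]] [l Hl]]]; try lra.
    apply continuous_Cmult; [|exact H2].
    exact (cderiv_rderiv_cont g (fun s => Phi x s) t l _ Hl H1). }
  (* Bottom and right sides count positively, top and left sides negatively: the boundary traversed
     counterclockwise. *)
  set (J := fun x y s => (Hz y x (x + s * wx)%R + Vt (x + s * wx)%R y (y + s * wy)%R
     - Hz (y + s * wy)%R x (x + s * wx)%R - Vt x y (y + s * wy)%R)%C).
  assert (HJ : J a c 1 = 0%C).
  2:{ unfold J in HJ. rewrite !Rmult_1_l in HJ. exact HJ. }
  apply (rectangle_bisection J a c wx wy Hwx Hwy).
  - intros x y s Hs X1 X2 Y1 Y2. unfold J.
    assert (S1 : 0 < s / 2 * wx) by (apply Rmult_lt_0_compat; lra).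
    assert (S2 : 0 < s / 2 * wy) by (apply Rmult_lt_0_compat; lra).
    assert (Ex : x + s * wx = x + s / 2 * wx + s / 2 * wx) by field.
    assert (Ey : y + s * wy = y + s / 2 * wy + s / 2 * wy) by field.
    rewrite Ex, Ey in *.
    (* Only the outer sides need splitting; each inner side of the four quarters occurs twice with
       opposite signs, and [ring] cancels it. *)
    rewrite (HzC y x (x + s / 2 * wx) (x + s / 2 * wx + s / 2 * wx)) by lra.
    rewrite (HzC (y + s / 2 * wy + s / 2 * wy) x (x + s / 2 * wx) (x + s / 2 * wx + s / 2 * wx)) by lra.
    rewrite (VtC x y (y + s / 2 * wy) (y + s / 2 * wy + s / 2 * wy)) by lra.
    rewrite (VtC (x + s / 2 * wx + s / 2 * wx) y (y + s / 2 * wy) (y + s / 2 * wy + s / 2 * wy)) by lra.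
    ring.
  - intros x0 y0 Hx0 Hy0 eps Heps.
    destruct (H x0 y0 Hx0 Hy0) as [_ [_ [l Hl]]].
    set (W := wx + wy). assert (HW : 0 < W) by (unfold W; lra).
    assert (HBW : 0 <= B * W) by (apply Rmult_le_pos; lra).
    (* The errors on the four sides will add up to [e * (2 * (B * W) ^ 2) * s ^ 2]; the summand 1
       only keeps the denominator positive. *)
    set (e := eps / (1 + 2 * (B * W) ^ 2)).
    assert (Hden : 0 < 1 + 2 * (B * W) ^ 2) by nra.
    assert (He : 0 < e) by (apply Rdiv_lt_0_compat; auto).
    destruct (proj1 (cderiv_eps _ _ _) Hl e He) as [d [Hd1 Hd2]].
    (* At scale [s] the image of the rectangle stays within [s * (B * W)] of [w0], hence within
       [d]. *)
    exists (d / (1 + B * W)). split; [apply Rdiv_lt_0_compat; lra|].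
    intros x y s Hs X1 X2 Y1 Y2.
    assert (S1 : 0 < s * wx) by (apply Rmult_lt_0_compat; lra).
    assert (S2 : 0 < s * wy) by (apply Rmult_lt_0_compat; lra).
    assert (Hsd : s * (B * W) < d).
    { destruct Hs as [Hs0 Hs1]. apply (Rmult_lt_compat_l (1 + B * W)) in Hs1; [|lra].
      replace ((1 + B * W) * (d / (1 + B * W))) with d in Hs1 by (field; lra). nra. }
    assert (Hnear : forall u v, x <= u <= x + s * wx -> y <= v <= y + s * wy ->
      Cmod (Phi u v - Phi x0 y0) <= s * (B * W)).
    { intros u v Hu Hv. eapply Rle_trans; [apply (Cmod_sub_triangle _ (Phi x0 v))|].
      assert (A1 : Cmod (Phi u v - Phi x0 v) <= s * wx * B).
      { apply (rderiv_lipschitz_abs (fun s => Phi s v) (fun s => Phi1 s v) a (a + wx)); try lra.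
        intros t Ht. apply H; lra. }
      assert (A2 : Cmod (Phi x0 v - Phi x0 y0) <= s * wy * B).
      { apply (rderiv_lipschitz_abs (fun s => Phi x0 s) (fun s => Phi2 x0 s) c (c + wy)); try lra.
        intros t Ht. apply H; lra. }
      unfold W. lra. }
    set (w0 := Phi x0 y0) in *.
    set (P := fun v => (g w0 * v + l * ((v - w0) * (v - w0)) / 2)%C).
    assert (HH : forall v, c <= v -> v <= c + wy -> y <= v <= y + s * wy ->
       Cmod (Hz v x (x + s * wx) - (P (Phi (x + s * wx)%R v) - P (Phi x v))) <= (x + s * wx - x) * (e * (s * (B * W)) * B)).
    { intros v Hv1 Hv2 Hv3. apply (path_integral_near g (fun s => Phi s v) (fun s => Phi1 s v)); try lra.
      intros t Ht. destruct (H t v) as [[H1 [H2 H3]] [_ H4]]; try lra.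
      specialize (Hnear t v Ht Hv3). exact (conj H1 (conj H2 (conj H3 (conj H4 (conj Hnear (Hd2 _ (Rle_lt_trans _ _ _ Hnear Hsd))))))). }
    assert (HV : forall u, a <= u -> u <= a + wx -> x <= u <= x + s * wx ->
       Cmod (Vt u y (y + s * wy) - (P (Phi u (y + s * wy)%R) - P (Phi u y))) <= (y + s * wy - y) * (e * (s * (B * W)) * B)).
    { intros u Hv1 Hv2 Hv3. apply (path_integral_near g (fun s => Phi u s) (fun s => Phi2 u s)); try lra.
      intros t Ht. destruct (H u t) as [_ [[H1 [H2 H3]] H4]]; try lra.
      specialize (Hnear u t Hv3 Ht). exact (conj H1 (conj H2 (conj H3 (conj H4 (conj Hnear (Hd2 _ (Rle_lt_trans _ _ _ Hnear Hsd))))))). }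
    pose proof (HH y ltac:(lra) ltac:(lra) ltac:(lra)) as E1.
    pose proof (HH (y + s * wy) ltac:(lra) ltac:(lra) ltac:(lra)) as E2.
    pose proof (HV x ltac:(lra) ltac:(lra) ltac:(lra)) as E3.
    pose proof (HV (x + s * wx) ltac:(lra) ltac:(lra) ltac:(lra)) as E4.
    set (z1 := (Hz y x (x + s * wx)%R - (P (Phi (x + s * wx)%R y) - P (Phi x y)))%C) in *.
    set (z2 := (Hz (y + s * wy)%R x (x + s * wx)%R - (P (Phi (x + s * wx)%R (y + s * wy)%R) - P (Phi x (y + s * wy)%R)))%C) in *.
    set (z3 := (Vt x y (y + s * wy)%R - (P (Phi x (y + s * wy)%R) - P (Phi x y)))%C) in *.
    set (z4 := (Vt (x + s * wx)%R y (y + s * wy)%R - (P (Phi (x + s * wx)%R (y + s * wy)%R) - P (Phi (x + s * wx)%R y)))%C) in *.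
    (* The values of [P] at the four corners cancel in this signed sum. *)
    assert (EJ : J x y s = (z1 + z4 + - z2 + - z3)%C) by (unfold J, z1, z2, z3, z4; ring).
    rewrite EJ.
    pose proof (Cmod_triangle (z1 + z4 + - z2) (- z3)).
    pose proof (Cmod_triangle (z1 + z4) (- z2)).
    pose proof (Cmod_triangle z1 z4).
    rewrite !Cmod_opp in *.
    assert (Et : 2 * ((x + s * wx - x) * (e * (s * (B * W)) * B)) + 2 * ((y + s * wy - y) * (e * (s * (B * W)) * B))
       = e * (2 * (B * W) ^ 2) * s ^ 2) by (unfold W; ring).
    assert (Ee : e * (2 * (B * W) ^ 2) <= eps).
    { replace eps with (e * (1 + 2 * (B * W) ^ 2)) by (unfold e; field; lra). nra. }
    assert (0 <= s ^ 2) by nra.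
    assert (e * (2 * (B * W) ^ 2) * s ^ 2 <= eps * s ^ 2) by (apply Rmult_le_compat_r; auto).
    lra.
Qed.

(** * Primitives in the disc *)

Lemma cderiv_unique (f : C -> C) (z l1 l2 : C) : cderiv f z l1 -> cderiv f z l2 -> l1 = l2.
Proof.
  intros H1 H2. rewrite <- (is_C_derive_unique _ _ _ H1). exact (is_C_derive_unique _ _ _ H2).
Qed.

Lemma cderiv_ext_loc (f g : C -> C) (z l : C) (r : R) : 0 < r ->
  (forall w, Cmod (w - z) < r -> f w = g w) -> cderiv f z l -> cderiv g z l.
Proof.
  intros Hr E H. apply cderiv_eps. intros eps He.
  destruct (proj1 (cderiv_eps _ _ _) H eps He) as [d [Hd1 Hd2]].
  exists (Rmin d r). split; [apply Rmin_pos; auto|]. intros w Hw.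
  rewrite <- !E.
  - apply Hd2. eapply Rlt_le_trans; [exact Hw|apply Rmin_l].
  - replace (z - z)%C with (RtoC 0) by ring. rewrite Cmod_0; auto.
  - eapply Rlt_le_trans; [exact Hw|apply Rmin_r].
Qed.

Lemma cderiv_const (c z : C) : cderiv (fun _ => c) z 0%C.
Proof. exact (@is_derive_const C_AbsRing C_NormedModule c z). Qed.

Lemma cderiv_id (z : C) : cderiv (fun w => w) z 1%C.
Proof. apply cderiv_field. exact (@is_derive_id C_AbsRing z). Qed.

Lemma cderiv_plus (f g : C -> C) (z a b : C) :
  cderiv f z a -> cderiv g z b -> cderiv (fun w => f w + g w)%C z (a + b)%C.
Proof. intros Hf Hg. exact (@is_derive_plus C_AbsRing C_NormedModule f g z a b Hf Hg). Qed.

Lemma cderiv_minus (f g : C -> C) (z a b : C) :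
  cderiv f z a -> cderiv g z b -> cderiv (fun w => f w - g w)%C z (a - b)%C.
Proof. intros Hf Hg. exact (@is_derive_minus C_AbsRing C_NormedModule f g z a b Hf Hg). Qed.

Lemma cderiv_mult (f g : C -> C) (z a b : C) :
  cderiv f z a -> cderiv g z b -> cderiv (fun w => f w * g w)%C z (a * g z + f z * b)%C.
Proof.
  intros Hf Hg. apply cderiv_field.
  apply (@is_derive_mult C_AbsRing f g z a b); [apply cderiv_field, Hf|apply cderiv_field, Hg|].
  intros x y. apply Cmult_comm.
Qed.

Lemma cderiv_scal (c : C) (f : C -> C) (z a : C) :
  cderiv f z a -> cderiv (fun w => c * f w)%C z (c * a)%C.
Proof.
  intros Hf. replace (c * a)%C with (0 * f z + c * a)%C by ring.
  apply (cderiv_mult (fun _ => c)); [apply cderiv_const|exact Hf].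
Qed.

Lemma cderiv_comp (f g : C -> C) (z l d : C) :
  cderiv f (g z) l -> cderiv g z d -> cderiv (fun w => f (g w)) z (d * l)%C.
Proof.
  intros Hf Hg. apply cderiv_field in Hg.
  exact (@is_derive_comp C_AbsRing C_NormedModule f g z l d Hf Hg).
Qed.

Lemma cderiv_inv (z : C) : z <> 0%C -> cderiv (fun w => / w)%C z (- / (z * z))%C.
Proof.
  intros Hz. apply cderiv_eps. intros eps He.
  assert (Hm := proj1 (Cmod_gt_0 z) Hz).
  assert (Hm3 : 0 < Cmod z ^ 3) by (apply pow_lt; auto).
  (* The first bound keeps [Cmod w] above [Cmod z / 2]; the second turns the remainder
     [(w - z)^2 / (w z^2)] into [eps * Cmod (w - z)]. *)
  exists (Rmin (Cmod z / 2) (eps * Cmod z ^ 3 / 2)). split.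
  { apply Rmin_pos; [lra|]. apply Rdiv_lt_0_compat; [apply Rmult_lt_0_compat; auto|lra]. }
  intros w Hw.
  assert (Hw1 := Rlt_le_trans _ _ _ Hw (Rmin_l _ _)).
  assert (Hw2 := Rlt_le_trans _ _ _ Hw (Rmin_r _ _)).
  pose proof (Cmod_le_sub z w) as T. rewrite Cmod_minus_sym in T.
  assert (Hwn : w <> 0%C) by (apply Cmod_gt_0; lra).
  replace (/ w - / z - (w - z) * - / (z * z))%C with ((w - z) * (w - z) * / (w * (z * z)))%C by (field; auto).
  rewrite !Cmod_mult, Cmod_inv by (repeat apply Cmult_neq_0; auto). rewrite !Cmod_mult.
  rewrite Rmult_assoc, (Rmult_comm eps).
  apply Rmult_le_compat_l; [apply Cmod_ge_0|].
  apply Rmult_le_reg_r with (Cmod w * (Cmod z * Cmod z)).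
  - repeat apply Rmult_lt_0_compat; lra.
  - rewrite Rmult_assoc, Rinv_l, Rmult_1_r.
    + apply Rle_trans with (eps * (Cmod z / 2 * (Cmod z * Cmod z))); [simpl in Hw2; lra|].
      apply Rmult_le_compat_l; [lra|]. apply Rmult_le_compat_r; [nra|lra].
    + apply Rgt_not_eq. repeat apply Rmult_lt_0_compat; lra.
Qed.

Definition contC (f : C -> C) (z : C) : Prop :=
  forall eps, 0 < eps -> exists del, 0 < del /\ forall w, Cmod (w - z) < del -> Cmod (f w - f z) < eps.

Lemma rderiv_affine (u v : C) (t : R) : rderiv (fun s => u + RtoC s * v)%C t v.
Proof.
  apply rderiv_eps. intros eps He. exists 1; split; [lra|]. intros s _.
  replace (u + RtoC s * v - (u + RtoC t * v) - RtoC (s - t) * v)%C with (RtoC 0) by (rewrite RtoC_minus; ring).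
  rewrite Cmod_0. apply Rmult_le_pos; [lra|apply Rabs_pos].
Qed.

Lemma contRC_ext (f g : R -> C) (t : R) : (forall s, f s = g s) -> contRC f t -> contRC g t.
Proof. intros E. apply (continuous_ext (U := C_UniformSpace) f g t E). Qed.

Lemma rderiv_ext (f g : R -> C) (t : R) (l : C) : (forall s, f s = g s) -> rderiv f t l -> rderiv g t l.
Proof. intros E. apply (is_derive_ext (V := C_R_NormedModule) f g t l E). Qed.

Lemma contRC_const (c : C) (t : R) : contRC (fun _ => c) t.
Proof. apply (continuous_const (V := C_UniformSpace)). Qed.

Lemma CInt_ext (f g : R -> C) (a b : R) : a <= b -> (forall t, a < t < b -> f t = g t) -> CInt f a b = CInt g a b.
Proof.
  intros Hab E. apply (@RInt_ext C_R_CompleteNormedModule).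
  rewrite Rmin_left, Rmax_right by lra. exact E.
Qed.

Lemma contC_affine (f : C -> C) (u v : C) (t : R) :
  contC f (u + RtoC t * v)%C -> contRC (fun s => f (u + RtoC s * v)%C) t.
Proof.
  intros H. apply continuous_C_eps. intros eps He. destruct (H eps He) as [d [Hd1 Hd2]].
  pose proof (Cmod_ge_0 v).
  exists (d / (1 + Cmod v)). split; [apply Rdiv_lt_0_compat; lra|]. intros s Hs. apply Hd2.
  replace (u + RtoC s * v - (u + RtoC t * v))%C with (RtoC (s - t) * v)%C by (rewrite RtoC_minus; ring).
  rewrite Cmod_mult, Cmod_R.
  apply (Rmult_lt_compat_l (1 + Cmod v)) in Hs; [|lra].
  replace ((1 + Cmod v) * (d / (1 + Cmod v))) with d in Hs by (field; lra).
  pose proof (Rabs_pos (s - t)). nra.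
Qed.

Lemma Cmod_segment (z w : C) (t r : R) : 0 <= t <= 1 -> Cmod z <= r -> Cmod w <= r ->
  Cmod (z + RtoC t * (w - z)) <= r.
Proof.
  intros Ht Hz Hw.
  replace (z + RtoC t * (w - z))%C with (RtoC (1 - t) * z + RtoC t * w)%C by (rewrite RtoC_minus; ring).
  eapply Rle_trans; [apply Cmod_triangle|]. rewrite !Cmod_mult, !Cmod_R, !Rabs_pos_eq by lra.
  assert ((1 - t) * Cmod z <= (1 - t) * r) by (apply Rmult_le_compat_l; lra).
  assert (t * Cmod w <= t * r) by (apply Rmult_le_compat_l; lra). lra.
Qed.

Lemma Cmod_scal_le (t : R) (z : C) : 0 <= t <= 1 -> Cmod (RtoC t * z) <= Cmod z.
Proof.
  intros Ht. rewrite Cmod_mult, Cmod_R, Rabs_pos_eq by lra. pose proof (Cmod_ge_0 z). nra.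
Qed.

Section Primitive.
(** In the application [q] is [f(w) / (w (1-w)^beta)], completed at 0 by its limit. Only continuity
    is asked there, since differentiability at 0 would amount to removing a singularity. *)
Variable q : C -> C.
Hypothesis q_diff : forall w, inD w -> w <> 0%C -> exists l, cderiv q w l.
Hypothesis q_cont0 : contC q 0%C.

Definition radial_int (z : C) : C := CInt (fun t => q (RtoC t * z) * z)%C 0 1.

Lemma q_contD (w : C) : inD w -> contC q w.
Proof.
  intros Hw. destruct (Ceq_dec w 0) as [->|E]; [exact q_cont0|].
  destruct (q_diff w Hw E) as [l Hl]. exact (cderiv_cont q w l Hl).
Qed.

Lemma radial_cont (z : C) (t : R) : inD z -> 0 <= t <= 1 -> contRC (fun t => q (RtoC t * z) * z)%C t.
Proof.
  intros Hz Ht. apply continuous_Cmult; [|apply contRC_const].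
  apply (contRC_ext (fun s => q (0 + RtoC s * z)%C)); [intros s; f_equal; ring|].
  apply contC_affine. apply q_contD. red.
  replace (0 + RtoC t * z)%C with (RtoC t * z)%C by ring.
  eapply Rle_lt_trans; [apply Cmod_scal_le; auto|exact Hz].
Qed.

Lemma radial_correct (z : C) : inD z ->
  @is_RInt C_R_NormedModule (fun t => q (RtoC t * z) * z)%C 0 1 (radial_int z).
Proof. intros Hz. apply CInt_correct; [lra|]. intros t Ht. apply radial_cont; auto. Qed.

Lemma segment_in_D (z h : C) (t : R) : Cmod h < 1 - Cmod z -> 0 <= t <= 1 -> inD (z + RtoC t * h)%C.
Proof.
  intros Hh Ht. red. eapply Rle_lt_trans; [apply Cmod_triangle|].
  pose proof (Cmod_scal_le t h Ht). lra.
Qed.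

Lemma segment_correct (z h : C) : Cmod h < 1 - Cmod z ->
  @is_RInt C_R_NormedModule (fun t => q (z + RtoC t * h) * h)%C 0 1 (CInt (fun t => q (z + RtoC t * h) * h)%C 0 1).
Proof.
  intros Hh. apply CInt_correct; [lra|]. intros t Ht.
  apply continuous_Cmult; [|apply contRC_const]. apply contC_affine, q_contD, segment_in_D; auto.
Qed.

(* Cauchy's theorem on the triangle with vertices 0, z, z + h, cut off at distance
   of order [e] from the possibly exceptional point 0. *)
Lemma radial_increment (z h : C) : z <> 0%C -> inD z -> Cmod h < Cmod z -> Cmod h < 1 - Cmod z ->
  (radial_int (z + h) - radial_int z)%C = CInt (fun t => q (z + RtoC t * h) * h)%C 0 1.
Proof.
  intros Hz0 HzD Hh1 Hh2. red in HzD.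
  destruct (q_cont0 1 ltac:(lra)) as [r [Hr1 Hr2]].
  set (K := 1 + Cmod (q 0)).
  assert (HK : forall w, Cmod w < r -> Cmod (q w) <= K).
  { intros w Hw. pose proof (Cmod_le_sub (q w) (q 0)). specialize (Hr2 w).
    replace (w - 0)%C with w in Hr2 by ring. unfold K. specialize (Hr2 Hw). lra. }
  assert (HK0 : 0 <= K) by (unfold K; pose proof (Cmod_ge_0 (q 0)); lra).
  set (D := (radial_int (z + h) - radial_int z - CInt (fun t => q (z + RtoC t * h) * h)%C 0 1)%C).
  assert (HzhD : inD (z + h)%C).
  { replace (z + h)%C with (z + RtoC 1 * h)%C by ring. apply segment_in_D; auto. lra. }
  (* By Cauchy's theorem away from the origin, [D] reduces to three short paths: the initial pieces
     of the two radii and the cross segment at parameter [e]. Each contributes at most [K * e]. *)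
  assert (Hbound : forall e, 0 < e < Rmin 1 r -> Cmod D <= 3 * K * e).
  { intros e He.
    assert (He1 : e < 1) by (apply Rlt_le_trans with (1 := proj2 He), Rmin_l).
    assert (He2 : e < r) by (apply Rlt_le_trans with (1 := proj2 He), Rmin_r).
    assert (Hsmall : forall w, inD w ->
       Cmod (CInt (fun t => q (RtoC t * w) * w)%C 0 e) <= (e - 0) * K).
    { intros w Hw. apply (CInt_bound (fun t => q (RtoC t * w) * w)%C); [lra| |].
      - apply CInt_correct; [lra|]. intros t Ht. apply radial_cont; auto. lra.
      - intros t Ht. rewrite Cmod_mult. red in Hw. pose proof (Cmod_ge_0 w).
        assert (B : Cmod (q (RtoC t * w)) <= K).
        { apply HK. rewrite Cmod_mult, Cmod_R, Rabs_pos_eq by lra. nra. }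
        pose proof (Cmod_ge_0 (q (RtoC t * w))). nra. }
    assert (Hsplit : forall w, inD w -> radial_int w =
       (CInt (fun t => q (RtoC t * w) * w)%C 0 e + CInt (fun t => q (RtoC t * w) * w)%C e 1)%C).
    { intros w Hw. apply CInt_Chasles; try lra. intros t Ht. apply radial_cont; auto. }
    (* Bottom and top of the parameter rectangle go to the radii towards [z] and [z + h], its right
       side to the segment between these points, its left side to the cross segment. *)
    pose proof (Cauchy_rectangle q (fun x y => RtoC x * (z + RtoC y * h))%C
      (fun x y => z + RtoC y * h)%C (fun x y => RtoC x * h)%C e 0 (1 - e) 1 1) as HC.
    cbv beta in HC.
    replace (e + (1 - e)) with 1 in HC by ring. replace (0 + 1) with 1 in HC by ring.
    specialize (HC ltac:(lra) ltac:(lra)).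
    set (L := CInt (fun s => q (RtoC e * (z + RtoC s * h)) * (RtoC e * h))%C 0 1) in HC.
    assert (HL : Cmod L <= (1 - 0) * (K * e)).
    { apply (CInt_bound (fun s => q (RtoC e * (z + RtoC s * h)) * (RtoC e * h))%C); [lra| |].
      - apply CInt_correct; [lra|]. intros t Ht.
        apply continuous_Cmult; [|apply contRC_const].
        apply (contRC_ext (fun s => q (RtoC e * z + RtoC s * (RtoC e * h))%C)); [intros s; f_equal; ring|].
        apply contC_affine, q_contD.
        replace (RtoC e * z + RtoC t * (RtoC e * h))%C with (RtoC e * (z + RtoC t * h))%C by ring.
        eapply Rle_lt_trans; [apply Cmod_scal_le; lra|]. apply segment_in_D; auto.
      - intros t Ht. rewrite !Cmod_mult, Cmod_R, Rabs_pos_eq by lra.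
        assert (B : Cmod (q (RtoC e * (z + RtoC t * h))) <= K).
        { apply HK. rewrite Cmod_mult, Cmod_R, Rabs_pos_eq by lra.
          pose proof (segment_in_D z h t Hh2 Ht) as S. red in S.
          pose proof (Cmod_ge_0 (z + RtoC t * h)). nra. }
        apply Rmult_le_compat; auto; try apply Cmod_ge_0.
        + apply Rmult_le_pos; [lra|apply Cmod_ge_0].
        + pose proof (Cmod_ge_0 h). nra. }
    rewrite (CInt_ext _ (fun t => q (RtoC t * z) * z)%C e 1) in HC
      by (try lra; intros; rewrite Cmult_0_l, Cplus_0_r; reflexivity).
    rewrite (CInt_ext (fun s => q (RtoC 1 * (z + RtoC s * h)) * (RtoC 1 * h))%C (fun t => q (z + RtoC t * h) * h)%C 0 1) in HC
      by (try lra; intros; rewrite !Cmult_1_l; reflexivity).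
    rewrite (CInt_ext (fun s => q (RtoC s * (z + RtoC 1 * h)) * (z + RtoC 1 * h))%C (fun t => q (RtoC t * (z + h)) * (z + h))%C e 1) in HC
      by (try lra; intros; rewrite !Cmult_1_l; reflexivity).
    assert (HD : D = (CInt (fun t => q (RtoC t * (z + h)) * (z + h))%C 0 e
        + - CInt (fun t => q (RtoC t * z) * z)%C 0 e + - L)%C).
    { unfold D. rewrite (Hsplit z), (Hsplit (z + h)%C) by auto.
      lapply HC; [clear HC; intros HC|clear HC].
      { match type of HC with ?Z = _ => match goal with |- _ = ?Y => transitivity (Y - Z)%C; [ring|rewrite HC; ring] end end. }
      intros x y Hx Hy. split; [|split].
      - split; [|split].
        + apply (rderiv_ext (fun s => 0 + RtoC s * (z + RtoC y * h))%C); [intros; ring|]. apply rderiv_affine.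
        + apply contRC_const.
        + apply Rlt_le, segment_in_D; auto.
      - split; [|split].
        + apply (rderiv_ext (fun s => RtoC x * z + RtoC s * (RtoC x * h))%C); [intros; ring|]. apply rderiv_affine.
        + apply contRC_const.
        + eapply Rle_trans; [apply Cmod_scal_le; lra|]. lra.
      - apply q_diff.
        + eapply Rle_lt_trans; [apply Cmod_scal_le; lra|]. apply segment_in_D; auto.
        + apply Cmult_neq_0.
          * intros X. apply RtoC_inj in X. lra.
          (* This is where [Cmod h < Cmod z] keeps the truncated triangle away from 0. *)
          * intros X. pose proof (Cmod_scal_le y h Hy) as S.
            replace (RtoC y * h)%C with (- z)%C in S.
            -- rewrite Cmod_opp in S. lra.
            -- replace (RtoC y * h)%C with ((z + RtoC y * h) - z)%C by ring. rewrite X; ring. }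
    rewrite HD.
    eapply Rle_trans; [apply Cmod_triangle|]. rewrite Cmod_opp.
    pose proof (Cmod_triangle (CInt (fun t => q (RtoC t * (z + h)) * (z + h))%C 0 e) (- CInt (fun t => q (RtoC t * z) * z)%C 0 e)) as T.
    rewrite Cmod_opp in T.
    pose proof (Hsmall z HzD). pose proof (Hsmall (z + h)%C HzhD). lra. }
  (* [D] does not depend on [e], so [e] may be taken arbitrarily small. *)
  assert (HD0 : D = 0%C).
  { apply Cmod_eq_0. destruct (Cmod_ge_0 D) as [P|P]; [exfalso|auto].
    assert (Hm : 0 < Rmin 1 r) by (apply Rmin_pos; lra).
    assert (Hq : 0 < Cmod D / (6 * K + 1)) by (apply Rdiv_lt_0_compat; lra).
    specialize (Hbound (Rmin (Rmin 1 r / 2) (Cmod D / (6 * K + 1)))).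
    assert (X : 3 * K * Rmin (Rmin 1 r / 2) (Cmod D / (6 * K + 1)) <= 3 * K * (Cmod D / (6 * K + 1))).
    { apply Rmult_le_compat_l; [lra|apply Rmin_r]. }
    assert (Y : (6 * K + 1) * (Cmod D / (6 * K + 1)) = Cmod D) by (field; lra).
    assert (Z : Cmod D <= 3 * K * Rmin (Rmin 1 r / 2) (Cmod D / (6 * K + 1))).
    { apply Hbound. split; [apply Rmin_pos; lra|]. eapply Rle_lt_trans; [apply Rmin_l|]. lra. }
    nra. }
  replace (radial_int (z + h) - radial_int z)%C with (D + CInt (fun t => q (z + RtoC t * h) * h)%C 0 1)%C
    by (unfold D; ring).
  rewrite HD0. ring.
Qed.

(** At [z = 0] the condition [Cmod h < Cmod z] of [radial_increment] cannot be met. Here the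
    triangle collapses, and both integrals run along the same radius. *)
Lemma radial_increment_0 (h : C) : inD h ->
  (radial_int (0 + h) - radial_int 0)%C = CInt (fun t => q (0 + RtoC t * h) * h)%C 0 1.
Proof.
  intros Hh. assert (E : radial_int 0 = 0%C).
  { unfold radial_int. rewrite (CInt_ext _ (fun _ => RtoC 0) 0 1) by (try lra; intros; ring).
    apply (@is_RInt_unique C_R_CompleteNormedModule).
    pose proof (@is_RInt_const C_R_NormedModule 0 1 (RtoC 0)) as I.
    rewrite Rminus_0_r, (@scal_one R_AbsRing C_R_NormedModule) in I. exact I. }
  rewrite E. replace (0 + h)%C with h by ring. unfold radial_int.
  replace (CInt (fun t => q (RtoC t * h) * h)%C 0 1 - 0)%C with (CInt (fun t => q (RtoC t * h) * h)%C 0 1) by ring.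
  apply CInt_ext; [lra|]. intros; rewrite Cplus_0_l; reflexivity.
Qed.

(** The increment is the integral of [q] along the segment from [z] to [z + h]; continuity of [q] at
    [z] makes it [h * q z] up to [eps * Cmod h]. *)
Theorem radial_primitive (z : C) : inD z -> cderiv radial_int z (q z).
Proof.
  intros Hz. assert (HzD := Hz). red in Hz.
  assert (Hr : exists r, 0 < r /\ r <= 1 - Cmod z /\ forall h, Cmod h < r ->
    (radial_int (z + h) - radial_int z)%C = CInt (fun t => q (z + RtoC t * h) * h)%C 0 1).
  { destruct (Ceq_dec z 0) as [->|E].
    - exists 1. rewrite Cmod_0 in *. split; [lra|]. split; [lra|]. intros h Hh. apply radial_increment_0. exact Hh.
    - assert (Hm := proj1 (Cmod_gt_0 z) E).
      exists (Rmin (Cmod z) (1 - Cmod z)). split; [apply Rmin_pos; lra|]. split; [apply Rmin_r|].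
      intros h Hh. apply radial_increment; auto.
      + eapply Rlt_le_trans; [exact Hh|apply Rmin_l].
      + eapply Rlt_le_trans; [exact Hh|apply Rmin_r]. }
  destruct Hr as [r [Hr0 [Hr1 Hr2]]].
  apply cderiv_eps. intros eps He.
  destruct (q_contD z HzD eps He) as [d [Hd1 Hd2]].
  exists (Rmin r d). split; [apply Rmin_pos; auto|]. intros w Hw.
  set (h := (w - z)%C) in *. replace w with (z + h)%C by (unfold h; ring).
  assert (Hh1 := Rlt_le_trans _ _ _ Hw (Rmin_l _ _)).
  assert (Hh2 := Rlt_le_trans _ _ _ Hw (Rmin_r _ _)).
  rewrite (Hr2 h Hh1).
  assert (Ic : @is_RInt C_R_NormedModule (fun _ => h * q z)%C 0 1 (h * q z)%C).
  { pose proof (@is_RInt_const C_R_NormedModule 0 1 (h * q z)%C) as I.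
    rewrite Rminus_0_r, (@scal_one R_AbsRing C_R_NormedModule) in I. exact I. }
  eapply Rle_trans.
  - apply (CInt_bound _ _ 0 1 (eps * Cmod h) ltac:(lra) (is_CInt_minus _ _ _ _ _ _ (segment_correct z h ltac:(lra)) Ic)).
    intros t Ht. replace (q (z + RtoC t * h) * h - h * q z)%C with ((q (z + RtoC t * h) - q z) * h)%C by ring.
    rewrite Cmod_mult. apply Rmult_le_compat_r; [apply Cmod_ge_0|]. apply Rlt_le, Hd2.
    replace (z + RtoC t * h - z)%C with (RtoC t * h)%C by ring.
    eapply Rle_lt_trans; [apply Cmod_scal_le; auto|exact Hh2].
  - lra.
Qed.
End Primitive.

(** * Cauchy's estimate *)

(* The integral of [u(w)/w^2 dw] is the same on all circles about 0, by Cauchy's theorem in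
   polar coordinates, and tends to [2 pi i u'(0)] on small ones. *)
Lemma Cauchy_estimate_0 (u : C -> C) (l : C) (M : R) :
  analytic_D u -> u 0%C = 0%C -> cderiv u 0 l -> (forall w, inD w -> Cmod (u w) <= M) ->
  Cmod l <= 2 * M.
Proof.
  intros Hu Hu0 Hl HM.
  set (polar := fun r th => (r * cos th, r * sin th) : C).
  assert (Hmod : forall r th, 0 <= r -> Cmod (polar r th) = r).
  { intros r th Hr. unfold polar, Cmod; simpl fst; simpl snd.
    replace ((r * cos th) ^ 2 + (r * sin th) ^ 2) with (Rsqr r * (Rsqr (sin th) + Rsqr (cos th))) by (unfold Rsqr; ring).
    rewrite sin2_cos2, Rmult_1_r. apply sqrt_Rsqr; auto. }
  assert (Hrot : forall r th, (- (r * sin th), r * cos th) = (Ci * polar r th)%C).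
  { intros r th. unfold polar, Ci, Cmult; simpl. f_equal; ring. }
  assert (Hpol : forall r th, rderiv (polar r) th (Ci * polar r th)%C).
  { intros r th. rewrite <- Hrot. unfold polar. apply rderiv_pair; auto_derive; auto; ring. }
  assert (Hne : forall r th, 0 < r -> polar r th <> 0%C).
  { intros r th Hr. apply Cmod_gt_0. rewrite Hmod; lra. }
  set (g := fun w => (u w * / (w * w))%C).
  assert (Hg : forall w, inD w -> w <> 0%C -> exists d, cderiv g w d).
  { intros w Hw Hw0. destruct (Hu w Hw) as [d Hd]. eexists.
    apply cderiv_mult; [exact Hd|].
    apply (cderiv_comp (fun v => / v)%C (fun v => v * v)%C).
    - apply cderiv_inv. apply Cmult_neq_0; auto.
    - apply cderiv_mult; apply cderiv_id. }
  (* On a circle about 0 one has [dw = i w dtheta], so [u/w^2 dw] becomes [i (u/w) dtheta]. *)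
  assert (HQ : forall r th, 0 < r -> (g (polar r th) * (Ci * polar r th))%C = (Ci * (u (polar r th) * / polar r th))%C).
  { intros r th Hr. unfold g. field. apply Hne; auto. }
  assert (Hcirc : forall r, 0 < r < 1 -> @is_RInt C_R_NormedModule (fun th => g (polar r th) * (Ci * polar r th))%C 0 (2 * PI)
     (CInt (fun th => g (polar r th) * (Ci * polar r th))%C 0 (2 * PI))).
  { pose proof PI_RGT_0. intros r Hr. apply CInt_correct; [lra|]. intros t Ht.
    destruct (Hg (polar r t)) as [d Hd]; [red; rewrite Hmod; lra|apply Hne; lra|].
    apply continuous_Cmult.
    - exact (cderiv_rderiv_cont g (polar r) t d _ Hd (Hpol r t)).
    - apply continuous_Cmult; [apply contRC_const|]. exact (rderiv_cont _ _ _ (Hpol r t)). }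
  apply Rle_plus_epsilon. intros eta Heta.
  destruct (proj1 (cderiv_eps _ _ _) Hl eta Heta) as [d [Hd1 Hd2]].
  (* The bound [/4] keeps the small circle inside the one of radius [/2]; the bound [d / 2] puts it
     where [u(w)/w] is within [eta] of [l]. *)
  set (e := Rmin (/4) (d / 2)).
  assert (He0 : 0 < e) by (apply Rmin_pos; lra).
  assert (He1 : e <= /4) by apply Rmin_l.
  assert (He2 : e <= d / 2) by apply Rmin_r.
  pose proof PI_RGT_0 as HPI.
  assert (Heq : CInt (fun th => g (polar (/2)%R th) * (Ci * polar (/2)%R th))%C 0 (2 * PI)
     = CInt (fun th => g (polar e th) * (Ci * polar e th))%C 0 (2 * PI)).
  { pose proof (Cauchy_rectangle g polar (fun r th => (cos th, sin th)) (fun r th => Ci * polar r th)%C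
      e 0 (/2 - e) (2 * PI) 1 ltac:(lra) ltac:(lra)) as HC.
    replace (e + (/2 - e)) with (/2) in HC by ring. rewrite Rplus_0_l in HC.
    lapply HC; [clear HC; intros HC|clear HC].
    - assert (E0 : forall r, polar r (2 * PI) = polar r 0).
      { intros r. unfold polar. rewrite cos_2PI, sin_2PI, cos_0, sin_0. reflexivity. }
      rewrite cos_2PI, sin_2PI, cos_0, sin_0 in HC.
      (* The sides at angles 0 and [2 * PI] have the same image and cancel, leaving the two
         circles. *)
      rewrite (CInt_ext (fun s => g (polar s (2 * PI)%R) * (1, 0))%C (fun s => g (polar s 0%R) * (1, 0))%C e (/2)) in HC
        by (try lra; intros; rewrite E0; reflexivity).
      match type of HC with ?Z = _ => match goal with |- _ = ?Y => transitivity (Y + Z)%C; [ring|rewrite HC; ring] end end.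
    - intros r th Hr Hth. split; [|split].
      + split; [|split].
        * apply rderiv_pair; auto_derive; auto; ring.
        * apply contRC_const.
        * pose proof (Hmod 1 th ltac:(lra)) as E. unfold polar in E. rewrite !Rmult_1_l in E. lra.
      + split; [|split].
        * apply Hpol.
        * apply continuous_Cmult; [apply contRC_const|]. exact (rderiv_cont _ _ _ (Hpol r th)).
        * rewrite Cmod_mult, Cmod_Ci, Hmod; lra.
      + apply Hg; [red; rewrite Hmod; lra|apply Hne; lra]. }
  pose proof (Hcirc (/2) ltac:(lra)) as I1. pose proof (Hcirc e ltac:(lra)) as I2.
  (* On the circle of radius [/2] the quotient [u(w)/w] is at most [2 * M], which is the factor 2 of
     the conclusion. *)
  assert (B1 : Cmod (CInt (fun th => g (polar (/2)%R th) * (Ci * polar (/2)%R th))%C 0 (2 * PI)) <= (2 * PI - 0) * (2 * M)).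
  { apply (CInt_bound _ _ 0 (2 * PI) (2 * M) ltac:(lra) I1). intros t Ht.
    rewrite HQ by lra. rewrite Cmod_mult, Cmod_Ci, Cmod_mult, Cmod_inv by (apply Hne; lra).
    rewrite Hmod by lra. rewrite Rinv_inv.
    assert (Cmod (u (polar (/2)%R t)) <= M) by (apply HM; red; rewrite Hmod; lra). lra. }
  assert (Ic : @is_RInt C_R_NormedModule (fun _ => Ci * l)%C 0 (2 * PI) (RtoC (2 * PI) * (Ci * l))%C).
  { pose proof (@is_RInt_const C_R_NormedModule 0 (2 * PI) (Ci * l)%C) as I.
    rewrite Rminus_0_r in I.
    replace (RtoC (2 * PI) * (Ci * l))%C with (@scal R_AbsRing C_R_NormedModule (2 * PI) (Ci * l)%C); [exact I|].
    destruct (Ci * l)%C as [x y]. unfold scal; simpl. unfold prod_scal, scal; simpl. unfold mult; simpl.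
    unfold Cmult; simpl. f_equal; ring. }
  assert (B2 : Cmod (CInt (fun th => g (polar e th) * (Ci * polar e th))%C 0 (2 * PI) - RtoC (2 * PI) * (Ci * l)) <= (2 * PI - 0) * eta).
  { apply (CInt_bound _ _ 0 (2 * PI) eta ltac:(lra) (is_CInt_minus _ _ _ _ _ _ I2 Ic)). intros t Ht.
    rewrite HQ by lra.
    set (w := polar e t). assert (Hw : Cmod w = e) by (apply Hmod; lra).
    assert (Hw0 : w <> 0%C) by (apply Hne; lra).
    replace (Ci * (u w * / w) - Ci * l)%C with (Ci * ((u w - u 0 - (w - 0) * l) * / w))%C by (rewrite Hu0; field; auto).
    rewrite !Cmod_mult, Cmod_Ci, Cmod_inv by auto.
    assert (Hb : Cmod (u w - u 0 - (w - 0) * l) <= eta * Cmod (w - 0)) by (apply Hd2; replace (w - 0)%C with w by ring; lra).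
    replace (Cmod (w - 0)) with e in Hb by (rewrite <- Hw; f_equal; ring).
    rewrite Hw, Rmult_1_l. apply Rmult_le_reg_r with e; auto.
    rewrite Rmult_assoc, Rinv_l, Rmult_1_r by lra. exact Hb. }
  rewrite <- Heq in B2.
  set (I := CInt (fun th => g (polar (/2)%R th) * (Ci * polar (/2)%R th))%C 0 (2 * PI)) in *.
  pose proof (Cmod_le_sub (RtoC (2 * PI) * (Ci * l)) I) as T. rewrite Cmod_minus_sym in T.
  rewrite !Cmod_mult, Cmod_Ci, Cmod_R, Rabs_pos_eq in T by lra.
  apply Rmult_le_reg_l with (2 * PI); lra.
Qed.

(** Rescaling to the unit disc and subtracting [u a] gives a function that vanishes at 0 and is
    bounded by [2 * M]; this doubling is why the constant is 4. *)
Lemma Cauchy_estimate (u : C -> C) (a l : C) (r M : R) : 0 < r ->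
  (forall w, Cmod (w - a) < r -> exists d, cderiv u w d) ->
  (forall w, Cmod (w - a) < r -> Cmod (u w) <= M) -> cderiv u a l ->
  Cmod l <= 4 * M / r.
Proof.
  intros Hr Hu HM Hl.
  set (U := fun z => (u (a + RtoC r * z) - u a)%C).
  assert (Hin : forall z, inD z -> Cmod (a + RtoC r * z - a) < r).
  { intros z Hz. replace (a + RtoC r * z - a)%C with (RtoC r * z)%C by ring.
    rewrite Cmod_mult, Cmod_R, Rabs_pos_eq by lra. red in Hz. nra. }
  assert (HU : forall z d, cderiv u (a + RtoC r * z)%C d -> cderiv U z ((0 + RtoC r * 1) * d - 0)%C).
  { intros z d Hd. apply cderiv_minus; [|apply cderiv_const].
    apply (cderiv_comp u (fun z => a + RtoC r * z)%C); [exact Hd|].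
    apply cderiv_plus; [apply cderiv_const|apply cderiv_scal, cderiv_id]. }
  assert (Ea : (a + RtoC r * 0)%C = a) by ring.
  assert (B : Cmod ((0 + RtoC r * 1) * l - 0) <= 2 * (2 * M)).
  { apply (Cauchy_estimate_0 U).
    - intros z Hz. destruct (Hu _ (Hin z Hz)) as [d Hd]. eexists. apply HU, Hd.
    - unfold U. rewrite Ea. ring.
    - apply HU. rewrite Ea. exact Hl.
    - intros w Hw. unfold U, Cminus. eapply Rle_trans; [apply Cmod_triangle|]. rewrite Cmod_opp.
      pose proof (HM _ (Hin w Hw)). assert (Cmod (u a) <= M).
      { apply HM. replace (a - a)%C with (RtoC 0) by ring. rewrite Cmod_0; auto. }
      lra. }
  replace ((0 + RtoC r * 1) * l - 0)%C with (RtoC r * l)%C in B by ring.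
  rewrite Cmod_mult, Cmod_R, Rabs_pos_eq in B by lra.
  apply Rmult_le_reg_l with r; auto. replace (r * (4 * M / r)) with (4 * M) by (field; lra). lra.
Qed.

(** * The kernel [(1-w)^(-beta)] *)

Lemma is_derive_eps (f : R -> R) (t l : R) : is_derive f t l ->
  forall eps, 0 < eps -> exists del, 0 < del /\
    forall s, Rabs (s - t) < del -> Rabs (f s - f t - (s - t) * l) <= eps * Rabs (s - t).
Proof.
  intros [_ H] eps He.
  destruct (H t (fun P h => h) (mkposreal eps He)) as [d Hd].
  exists d; split; [apply cond_pos|]. intros w Hw. exact (Hd w Hw).
Qed.

Lemma Cmod_le_components (z : C) : Cmod z <= Rabs (fst z) + Rabs (snd z).
Proof.
  destruct z as [x y]. replace (x, y) with (RtoC x + Ci * RtoC y)%C.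
  - eapply Rle_trans; [apply Cmod_triangle|]. rewrite Cmod_mult, Cmod_Ci, !Cmod_R. simpl.
    rewrite Rmult_0_r, Rplus_0_l. ring_simplify (0 * 0). rewrite Rmult_1_l.
    replace (x + _) with x by ring. apply Rplus_le_compat; apply Req_le; f_equal; ring.
  - unfold Cplus, Cmult, Ci, RtoC; simpl. f_equal; ring.
Qed.

Lemma Rabs_snd_le_Cmod (z : C) : Rabs (snd z) <= Cmod z.
Proof. eapply Rle_trans; [apply Rmax_r|apply Rmax_Cmod]. Qed.

Definition Cexp (w : C) : C := (exp (fst w) * cos (snd w), exp (fst w) * sin (snd w)).

Lemma Cexp_plus (a b : C) : Cexp (a + b) = (Cexp a * Cexp b)%C.
Proof.
  unfold Cexp, Cplus, Cmult; simpl. rewrite exp_plus, cos_plus, sin_plus. f_equal; ring.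
Qed.

Lemma Cexp_0 : Cexp 0 = 1%C.
Proof. unfold Cexp; simpl. rewrite exp_0, cos_0, sin_0. unfold RtoC. f_equal; ring. Qed.

Lemma Cmod_Cexp (w : C) : Cmod (Cexp w) = exp (fst w).
Proof.
  unfold Cexp, Cmod; simpl fst; simpl snd.
  replace ((exp (fst w) * cos (snd w)) ^ 2 + (exp (fst w) * sin (snd w)) ^ 2)
    with (Rsqr (exp (fst w)) * (Rsqr (sin (snd w)) + Rsqr (cos (snd w)))) by (unfold Rsqr; ring).
  rewrite sin2_cos2, Rmult_1_r. apply sqrt_Rsqr, Rlt_le, exp_pos.
Qed.

Lemma Cexp_neq_0 (w : C) : Cexp w <> 0%C.
Proof. apply Cmod_gt_0. rewrite Cmod_Cexp. apply exp_pos. Qed.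

Lemma cderiv_Cexp_0 : cderiv Cexp 0 1%C.
Proof.
  apply cderiv_eps. intros eps He.
  (* Each component of the remainder will be at most [3 * (e * m)], whence the 6. The cap 1 helps to
     keep [1 + x] and [exp x] below 2. *)
  set (e := Rmin 1 (eps / 6)). assert (He0 : 0 < e) by (apply Rmin_pos; lra).
  assert (He1 : e <= 1) by apply Rmin_l. assert (He2 : e <= eps / 6) by apply Rmin_r.
  destruct (is_derive_eps exp 0 1) with (eps := e) as [d1 [Hd1 H1]]; auto.
  { auto_derive; auto. rewrite exp_0; ring. }
  destruct (is_derive_eps cos 0 0) with (eps := e) as [d2 [Hd2 H2]]; auto.
  { auto_derive; auto. rewrite sin_0; ring. }
  destruct (is_derive_eps sin 0 1) with (eps := e) as [d3 [Hd3 H3]]; auto.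
  { auto_derive; auto. rewrite cos_0; ring. }
  exists (Rmin (Rmin d1 d2) (Rmin d3 (e / 2))). split; [repeat apply Rmin_pos; lra|].
  intros w Hw. replace (w - 0)%C with w in * by ring. rewrite Cexp_0.
  assert (W1 := Rlt_le_trans _ _ _ Hw (Rmin_l _ _)). assert (W2 := Rlt_le_trans _ _ _ Hw (Rmin_r _ _)).
  assert (W3 := Rlt_le_trans _ _ _ W1 (Rmin_l _ _)). assert (W4 := Rlt_le_trans _ _ _ W1 (Rmin_r _ _)).
  assert (W5 := Rlt_le_trans _ _ _ W2 (Rmin_l _ _)). assert (W6 := Rlt_le_trans _ _ _ W2 (Rmin_r _ _)).
  pose proof (re_le_Cmod w) as Hx. unfold Re in Hx. pose proof (Rabs_snd_le_Cmod w) as Hy.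
  pose proof (Cmod_ge_0 w) as Hw0.
  destruct w as [x y]; simpl fst in *; simpl snd in *.
  specialize (H1 x). specialize (H2 y). specialize (H3 y). rewrite !Rminus_0_r in *.
  rewrite exp_0 in H1. rewrite cos_0 in H2. rewrite sin_0 in H3.
  specialize (H1 ltac:(lra)). specialize (H2 ltac:(lra)). specialize (H3 ltac:(lra)).
  rewrite Rmult_0_r, Rminus_0_r in H2. rewrite Rmult_1_r in H1. rewrite Rminus_0_r, Rmult_1_r in H3.
  set (m := Cmod (x, y)) in *.
  assert (A1 : Rabs (exp x - 1 - x) <= e * m) by (apply Rle_trans with (1 := H1), Rmult_le_compat_l; lra).
  assert (A2 : Rabs (cos y - 1) <= e * m) by (apply Rle_trans with (1 := H2), Rmult_le_compat_l; lra).
  assert (A3 : Rabs (sin y - y) <= e * m) by (apply Rle_trans with (1 := H3), Rmult_le_compat_l; lra).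
  assert (A4 : Rabs (exp x - 1) <= e).
  { replace (exp x - 1) with ((exp x - 1 - x) + x) by ring. eapply Rle_trans; [apply Rabs_triang|]. nra. }
  eapply Rle_trans; [apply Cmod_le_components|].
  unfold Cexp; simpl.
  replace (exp x * cos y + - (1) + - (x * 1 - y * 0)) with ((exp x - 1 - x) * cos y + (1 + x) * (cos y - 1)) by ring.
  replace (exp x * sin y + - 0 + - (x * 0 + y * 1)) with (exp x * (sin y - y) + y * (exp x - 1)) by ring.
  assert (B1 : Rabs ((exp x - 1 - x) * cos y + (1 + x) * (cos y - 1)) <= 3 * (e * m)).
  { eapply Rle_trans; [apply Rabs_triang|]. rewrite !Rabs_mult.
    assert (C1 : Rabs (cos y) <= 1) by (apply Rabs_le; pose proof (COS_bound y); lra).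
    assert (C2 : Rabs (1 + x) <= 2) by (eapply Rle_trans; [apply Rabs_triang|]; rewrite Rabs_R1; lra).
    pose proof (Rabs_pos (exp x - 1 - x)). pose proof (Rabs_pos (cos y - 1)).
    pose proof (Rabs_pos (cos y)). pose proof (Rabs_pos (1 + x)). nra. }
  assert (B2 : Rabs (exp x * (sin y - y) + y * (exp x - 1)) <= 3 * (e * m)).
  { eapply Rle_trans; [apply Rabs_triang|]. rewrite !Rabs_mult.
    assert (C2 : Rabs (exp x) <= 2).
    { replace (exp x) with (1 + (exp x - 1)) by ring. eapply Rle_trans; [apply Rabs_triang|]; rewrite Rabs_R1; lra. }
    pose proof (Rabs_pos (sin y - y)). pose proof (Rabs_pos (exp x)). pose proof (Rabs_pos y). pose proof (Rabs_pos (exp x - 1)). nra. }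
  assert (e * m <= eps / 6 * m) by (apply Rmult_le_compat_r; auto). lra.
Qed.

Lemma cderiv_Cexp (z : C) : cderiv Cexp z (Cexp z).
Proof.
  apply (cderiv_ext_loc (fun w => Cexp z * Cexp (w - z))%C _ z _ 1 ltac:(lra)).
  - intros w _. rewrite <- Cexp_plus. f_equal. ring.
  - cut (cderiv (fun w => Cexp z * Cexp (w - z))%C z (Cexp z * ((1 - 0) * 1))%C).
    { intros H. replace (Cexp z * ((1 - 0) * 1))%C with (Cexp z) in H by ring. exact H. }
    apply cderiv_scal, (cderiv_comp Cexp (fun w => w - z)%C).
    + replace (z - z)%C with (RtoC 0) by ring. apply cderiv_Cexp_0.
    + apply cderiv_minus; [apply cderiv_id|apply cderiv_const].
Qed.

(** For [w] in the disc, [1 - w] lies in the right half-plane, where [Arg] is a single arctangent.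
    Inversion, continuity and differentiability are therefore proved only there. *)
Definition Clog (u : C) : C := (ln (Cmod u), Arg u).

Lemma Arg_right (u : C) : 0 < fst u -> Arg u = atan (snd u / fst u).
Proof. intros H. unfold Arg. destruct Rlt_dec; [reflexivity|contradiction]. Qed.

Lemma Cexp_Clog (u : C) : 0 < fst u -> Cexp (Clog u) = u.
Proof.
  intros Hu. unfold Cexp, Clog; simpl fst; simpl snd. rewrite Arg_right by auto.
  assert (Hm : 0 < Cmod u).
  { pose proof (re_le_Cmod u) as H. unfold Re in H. rewrite Rabs_pos_eq in H by lra. lra. }
  rewrite exp_ln, cos_atan, sin_atan by auto.
  destruct u as [x y]; simpl in *.
  assert (E : Cmod (x, y) = x * sqrt (1 + Rsqr (y / x))).
  { unfold Cmod; simpl fst; simpl snd. rewrite <- (sqrt_Rsqr x) at 2 by lra.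
    rewrite <- sqrt_mult_alt by apply Rle_0_sqr. f_equal. unfold Rsqr. field. lra. }
  rewrite E in *.
  assert (0 < sqrt (1 + Rsqr (y / x))).
  { apply sqrt_lt_R0. pose proof (Rle_0_sqr (y / x)). lra. }
  f_equal; field; lra.
Qed.

Lemma Clog_cont (u : C) : 0 < fst u -> contC Clog u.
Proof.
  intros Hu eps He.
  assert (Hm : 0 < Cmod u).
  { pose proof (re_le_Cmod u) as H. unfold Re in H. rewrite Rabs_pos_eq in H by lra. lra. }
  assert (C1 : continuous ln (Cmod u)).
  { apply (ex_derive_continuous (V := R_NormedModule)). exists (/ Cmod u). apply is_derive_ln; auto. }
  destruct (proj1 (filterlim_locally (F := locally (Cmod u)) ln (ln (Cmod u))) C1 (mkposreal (eps / 2) ltac:(lra))) as [d1 H1].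
  assert (C2 : continuous (fun v : C_UniformSpace => atan (snd v / fst v)) (u : C_UniformSpace)).
  { apply (continuous_comp (fun v : C_UniformSpace => snd v / fst v) atan).
    - apply (continuous_mult (K := R_AbsRing)).
      + apply continuous_snd.
      + change (@continuous C_UniformSpace R_UniformSpace (fun v => / fst v) u).
        apply (continuous_comp (fun v : C_UniformSpace => fst v) Rinv); [apply continuous_fst|].
        apply continuous_Rinv; lra.
    - apply (ex_derive_continuous (V := R_NormedModule)). eexists. apply is_derive_atan. }
  destruct (proj1 (filterlim_locally (F := locally (u : C_UniformSpace)) _ (atan (snd u / fst u))) C2 (mkposreal (eps / 2) ltac:(lra))) as [d2 H2].
  exists (Rmin (fst u) (Rmin d1 d2)). split.
  { repeat apply Rmin_pos; auto; apply cond_pos. }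
  intros v Hv.
  assert (V1 := Rlt_le_trans _ _ _ Hv (Rmin_l _ _)). assert (V2 := Rlt_le_trans _ _ _ Hv (Rmin_r _ _)).
  assert (V3 := Rlt_le_trans _ _ _ V2 (Rmin_l _ _)). assert (V4 := Rlt_le_trans _ _ _ V2 (Rmin_r _ _)).
  assert (Hfv : 0 < fst v).
  { pose proof (re_le_Cmod (v - u)) as H. unfold Re in H. simpl in H. apply Rabs_le_between in H. lra. }
  eapply Rle_lt_trans; [apply Cmod_le_components|].
  unfold Clog; simpl fst; simpl snd. rewrite !Arg_right by auto.
  assert (B1 : Rabs (ln (Cmod v) - ln (Cmod u)) < eps / 2).
  { apply (H1 (Cmod v)). change (Rabs (Cmod v - Cmod u) < d1).
    eapply Rle_lt_trans; [|exact V3]. apply Rabs_le.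
    pose proof (Cmod_le_sub v u). pose proof (Cmod_le_sub u v) as X. rewrite (Cmod_minus_sym u v) in X. lra. }
  assert (B2 : Rabs (atan (snd v / fst v) - atan (snd u / fst u)) < eps / 2).
  { apply (H2 v). apply C_NormedModule_mixin_compat1. exact V4. }
  unfold Rminus in B1, B2. lra.
Qed.

(** The inverse function argument: for [k = Clog v - Clog u] the addition formula gives
    [Cexp k = v / u], so [h = (v - u) / u] equals [Cexp k - 1], and continuity of [Clog] makes [k]
    small enough for the derivative of [Cexp] at 0 to give [Cmod (h - k) <= e * Cmod k]. With
    [e <= /2] this also yields [Cmod k <= 2 * Cmod h]. *)
Lemma cderiv_Clog (u : C) : 0 < fst u -> cderiv Clog u (/ u)%C.
Proof.
  intros Hu. apply cderiv_eps. intros eps He.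
  assert (Hu0 : u <> 0%C) by (intros ->; simpl in Hu; lra).
  assert (Hm := proj1 (Cmod_gt_0 u) Hu0).
  set (e := Rmin (/2) (eps * Cmod u / 2)).
  assert (He0 : 0 < e) by (apply Rmin_pos; [lra|]; apply Rdiv_lt_0_compat; [apply Rmult_lt_0_compat|]; lra).
  assert (He1 : e <= /2) by apply Rmin_l. assert (He2 : e <= eps * Cmod u / 2) by apply Rmin_r.
  destruct (proj1 (cderiv_eps _ _ _) cderiv_Cexp_0 e He0) as [d [Hd1 Hd2]].
  destruct (Clog_cont u Hu d Hd1) as [r [Hr1 Hr2]].
  exists (Rmin (fst u) r). split; [apply Rmin_pos; auto|]. intros v Hv.
  assert (V1 := Rlt_le_trans _ _ _ Hv (Rmin_l _ _)). assert (V2 := Rlt_le_trans _ _ _ Hv (Rmin_r _ _)).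
  assert (Hfv : 0 < fst v).
  { pose proof (re_le_Cmod (v - u)) as H. unfold Re in H. simpl in H. apply Rabs_le_between in H. lra. }
  set (k := (Clog v - Clog u)%C). set (h := ((v - u) * / u)%C).
  assert (Hk : Cmod (k - 0) < d) by (replace (k - 0)%C with k by ring; apply Hr2; auto).
  specialize (Hd2 k Hk). rewrite Cexp_0 in Hd2.
  assert (Ek : Cexp k = (v * / u)%C).
  { assert (E : (Cexp k * Cexp (Clog u))%C = Cexp (Clog v)) by (rewrite <- Cexp_plus; f_equal; unfold k; ring).
    rewrite !Cexp_Clog in E by auto. rewrite <- E. field. auto. }
  rewrite Ek in Hd2.
  replace (v * / u - 1 - (k - 0) * 1)%C with (h - k)%C in Hd2 by (unfold h; field; auto).
  replace (k - 0)%C with k in Hd2 by ring.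
  pose proof (Cmod_le_sub k h) as T. rewrite (Cmod_minus_sym k h) in T.
  pose proof (Cmod_ge_0 k).
  assert (Hkh : Cmod k <= 2 * Cmod h) by nra.
  rewrite Cmod_minus_sym. eapply Rle_trans; [exact Hd2|].
  assert (Eh : Cmod h = Cmod (v - u) / Cmod u) by (unfold h; rewrite Cmod_mult, Cmod_inv by auto; reflexivity).
  pose proof (Cmod_ge_0 h).
  apply Rle_trans with (eps * Cmod u / 2 * (2 * Cmod h)); [apply Rmult_le_compat; lra|].
  rewrite Eh. right. field. lra.
Qed.

Lemma Cpow_Cexp (u : C) (b : R) : Cpow u b = Cexp (RtoC b * Clog u).
Proof.
  unfold Cpow, Cexp, Clog, RtoC, Cmult; simpl. f_equal; f_equal; f_equal; ring.
Qed.

Lemma Cmod_Cpow (u : C) (b : R) : Cmod (Cpow u b) = Rpower (Cmod u) b.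
Proof.
  rewrite Cpow_Cexp, Cmod_Cexp. unfold Rpower, Clog, RtoC, Cmult; simpl. f_equal. ring.
Qed.

Lemma Cpow_neq_0 (u : C) (b : R) : Cpow u b <> 0%C.
Proof. rewrite Cpow_Cexp. apply Cexp_neq_0. Qed.

Lemma cderiv_Cpow (u : C) (b : R) : 0 < fst u ->
  cderiv (fun v => Cpow v b) u (RtoC b * / u * Cpow u b)%C.
Proof.
  intros Hu. rewrite Cpow_Cexp.
  apply (cderiv_ext_loc (fun v => Cexp (RtoC b * Clog v)) _ u _ 1 ltac:(lra)).
  - intros w _. symmetry. apply Cpow_Cexp.
  - apply (cderiv_comp Cexp (fun v => RtoC b * Clog v)%C); [apply cderiv_Cexp|].
    apply cderiv_scal, cderiv_Clog, Hu.
Qed.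

Definition cesaro_kernel (beta : R) (w : C) : C := (/ Cpow (1 - w) beta)%C.

Lemma cesaro_kernel_analytic (beta : R) : analytic_D (cesaro_kernel beta).
Proof.
  intros w Hw. eexists. unfold cesaro_kernel.
  apply (cderiv_comp (fun v => / v)%C (fun w => Cpow (1 - w) beta)).
  - apply cderiv_inv, Cpow_neq_0.
  - apply (cderiv_comp (fun v => Cpow v beta) (fun w => 1 - w)%C).
    + apply cderiv_Cpow. simpl. red in Hw. pose proof (re_le_Cmod w) as H. unfold Re in H.
      apply Rabs_le_between in H. lra.
    + apply cderiv_minus; [apply cderiv_const|apply cderiv_id].
Qed.

Lemma Cmod_cesaro_kernel (beta : R) (w : C) : Cmod (cesaro_kernel beta w) = Rpower (Cmod (1 - w)) (- beta).
Proof.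
  unfold cesaro_kernel. rewrite Cmod_inv by apply Cpow_neq_0. rewrite Cmod_Cpow, Rpower_Ropp. reflexivity.
Qed.

(** * The derivative of the Cesaro operator *)

Lemma inD_0 : inD 0%C.
Proof. red. rewrite Cmod_0. lra. Qed.

Lemma bweight_pos (alpha : R) (z : C) : 0 < bweight alpha z.
Proof. apply exp_pos. Qed.

Lemma bweight_0 (alpha : R) : bweight alpha 0 = 1.
Proof. unfold bweight. rewrite Cmod_0. replace (1 - 0 ^ 2) with 1 by ring. unfold Rpower. rewrite ln_1, Rmult_0_r. apply exp_0. Qed.

Lemma bloch_norm_ub (alpha : R) (f : C -> C) (z l : C) : in_B0 alpha f -> inD z -> cderiv f z l ->
  bweight alpha z * Cmod l <= bloch_norm alpha f.
Proof.
  intros [_ [Hfin _]] Hz Hl.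
  destruct (Lub_Rbar_correct (bloch_vals alpha f)) as [Hub _].
  specialize (Hub (bweight alpha z * Cmod l) ltac:(exists z, l; auto)).
  unfold bloch_norm, bloch_norm_bar in *. rewrite <- Hfin in Hub. exact Hub.
Qed.

Lemma bloch_norm_bar_le (alpha : R) (f : C -> C) (M : R) : analytic_D f ->
  (forall z l, inD z -> cderiv f z l -> bweight alpha z * Cmod l <= M) ->
  is_finite (bloch_norm_bar alpha f) /\ bloch_norm alpha f <= M.
Proof.
  intros Hf HM. destruct (Hf _ inD_0) as [l Hl].
  destruct (Lub_Rbar_correct (bloch_vals alpha f)) as [Hub Hleast].
  specialize (Hub (bweight alpha 0 * Cmod l) ltac:(exists 0%C, l; auto using inD_0)).
  specialize (Hleast (Finite M)).
  assert (HL : Rbar_le (Lub_Rbar (bloch_vals alpha f)) M).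
  { apply Hleast. intros r [z [d [Hz [Hd ->]]]]. simpl. apply HM; auto. }
  unfold bloch_norm, bloch_norm_bar.
  destruct (Lub_Rbar (bloch_vals alpha f)) as [x| |]; simpl in *; try contradiction.
  split; [reflexivity|exact HL].
Qed.

Lemma bloch_norm_nonneg (alpha : R) (f : C -> C) : in_B0 alpha f -> 0 <= bloch_norm alpha f.
Proof.
  intros Hf. destruct Hf as [Ha Hr] eqn:E. destruct (Ha _ inD_0) as [l Hl].
  eapply Rle_trans; [|exact (bloch_norm_ub alpha f 0 l Hf inD_0 Hl)].
  apply Rmult_le_pos; [apply Rlt_le, bweight_pos|apply Cmod_ge_0].
Qed.

Lemma in_B0_intro (alpha : R) (f : C -> C) (M : R) : analytic_D f -> f 0%C = 0%C ->
  (forall z l, inD z -> cderiv f z l -> bweight alpha z * Cmod l <= M) ->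
  in_B0 alpha f /\ bloch_norm alpha f <= M.
Proof.
  intros Hf H0 HM. destruct (bloch_norm_bar_le alpha f M Hf HM) as [H1 H2].
  repeat split; auto.
Qed.

(** When [F] vanishes at 0 and is differentiable there, the value at 0 is the limit of [F w / w]; it
    replaces the conventional value of a division by 0. *)
Definition quot (F : C -> C) (w : C) : C := if Ceq_dec w 0 then C_derive F 0 else (F w / w)%C.

Lemma quot_at_0 (F : C -> C) (l : C) : cderiv F 0 l -> quot F 0 = l.
Proof.
  intros H. unfold quot. destruct Ceq_dec as [_|E]; [|congruence]. exact (is_C_derive_unique _ _ _ H).
Qed.

Lemma quot_off_0 (F : C -> C) (w : C) : w <> 0%C -> quot F w = (F w / w)%C.
Proof. intros H. unfold quot. destruct Ceq_dec; [contradiction|reflexivity]. Qed.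

Lemma quot_cont_0 (F : C -> C) : analytic_D F -> F 0%C = 0%C -> contC (quot F) 0%C.
Proof.
  intros HF H0 eps He. destruct (HF _ inD_0) as [l Hl].
  destruct (proj1 (cderiv_eps _ _ _) Hl (eps / 2) ltac:(lra)) as [d [Hd1 Hd2]].
  exists d; split; auto. intros w Hw. rewrite (quot_at_0 F l Hl).
  destruct (Ceq_dec w 0) as [->|E].
  - rewrite (quot_at_0 F l Hl). replace (l - l)%C with (RtoC 0) by ring. rewrite Cmod_0; auto.
  - rewrite quot_off_0 by auto. specialize (Hd2 w Hw). rewrite H0 in Hd2.
    replace (F w - 0 - (w - 0) * l)%C with ((F w / w - l) * w)%C in Hd2 by (field; auto).
    replace (w - 0)%C with w in Hd2 by ring. rewrite Cmod_mult in Hd2.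
    apply Rmult_le_reg_r in Hd2; [lra|]. apply Cmod_gt_0; auto.
Qed.

Lemma quot_diff (F : C -> C) (w : C) : analytic_D F -> inD w -> w <> 0%C -> exists l, cderiv (quot F) w l.
Proof.
  intros HF Hw E. destruct (HF w Hw) as [l Hl]. eexists.
  apply (cderiv_ext_loc (fun v => F v * / v)%C _ w _ (Cmod w)).
  - apply Cmod_gt_0; auto.
  - intros v Hv. rewrite quot_off_0; [reflexivity|]. intros ->.
    replace (0 - w)%C with (- w)%C in Hv by ring. rewrite Cmod_opp in Hv. lra.
  - apply cderiv_mult; [exact Hl|apply cderiv_inv; auto].
Qed.

Definition cesaro_deriv (beta : R) (f : C -> C) : C -> C := quot (fun w => f w * cesaro_kernel beta w)%C.

Lemma mult_kernel_analytic (beta : R) (f : C -> C) : analytic_D f ->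
  analytic_D (fun w => f w * cesaro_kernel beta w)%C.
Proof.
  intros Hf w Hw. destruct (Hf w Hw) as [l Hl]. destruct (cesaro_kernel_analytic beta w Hw) as [m Hm].
  eexists. apply cderiv_mult; eassumption.
Qed.

Lemma mult_kernel_0 (beta : R) (f : C -> C) : f 0%C = 0%C -> (f 0%C * cesaro_kernel beta 0%C)%C = 0%C.
Proof. intros ->. ring. Qed.

(** The two integrands may disagree at [t = 0], where [cesaro_integrand] divides by 0; an integral
    ignores that endpoint. [RInt_fct_extend_pair] identifies the integral in C with the pair of real
    integrals. *)
Lemma cesaro_radial (beta : R) (f : C -> C) (z : C) : analytic_D f -> f 0%C = 0%C -> inD z ->
  cesaro beta f z = radial_int (cesaro_deriv beta f) z.
Proof.
  intros Hf H0 Hz.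
  assert (HI := radial_correct (cesaro_deriv beta f)
    (fun w => quot_diff _ w (mult_kernel_analytic beta f Hf))
    (quot_cont_0 _ (mult_kernel_analytic beta f Hf) (mult_kernel_0 beta f H0)) z Hz).
  apply (is_RInt_ext (V := C_R_NormedModule) _ (cesaro_integrand beta f z)) in HI.
  - unfold cesaro.
    exact (RInt_fct_extend_pair (U := R_NormedModule) (V := R_NormedModule) (@RInt R_CompleteNormedModule) (@RInt R_CompleteNormedModule)
      (fun f a b l H => is_RInt_unique (V := R_CompleteNormedModule) f a b l H)
      (fun f a b l H => is_RInt_unique (V := R_CompleteNormedModule) f a b l H)
      (cesaro_integrand beta f z) 0 1 _ HI).
  - rewrite Rmin_left, Rmax_right by lra. intros t Ht. unfold cesaro_integrand, cesaro_deriv.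
    match goal with |- ?a = ?b => change (@eq C a b) end.
    destruct (Ceq_dec z 0) as [->|E].
    + unfold Cdiv. ring.
    + assert (Ht0 : RtoC t <> 0%C) by (intros X; apply RtoC_inj in X; lra).
      rewrite quot_off_0 by (apply Cmult_neq_0; auto). unfold cesaro_kernel.
      pose proof (Cpow_neq_0 (1 - RtoC t * z) beta). field. repeat split; auto.
Qed.

Lemma cderiv_cesaro (beta : R) (f : C -> C) (z : C) : analytic_D f -> f 0%C = 0%C -> inD z ->
  cderiv (cesaro beta f) z (cesaro_deriv beta f z).
Proof.
  intros Hf H0 Hz.
  apply (cderiv_ext_loc (radial_int (cesaro_deriv beta f)) _ z _ (1 - Cmod z)).
  - red in Hz. lra.
  - intros w Hw. symmetry. apply cesaro_radial; auto. red.
    pose proof (Cmod_le_sub w z). lra.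
  - apply radial_primitive; auto.
    + intros w. exact (quot_diff _ w (mult_kernel_analytic beta f Hf)).
    + exact (quot_cont_0 _ (mult_kernel_analytic beta f Hf) (mult_kernel_0 beta f H0)).
Qed.

Lemma cesaro_at_0 (beta : R) (f : C -> C) : cesaro beta f 0%C = 0%C.
Proof.
  assert (E : forall t, cesaro_integrand beta f 0 t = 0%C) by (intros t; unfold cesaro_integrand, Cdiv; ring).
  assert (Z : RInt (fun _ => 0) 0 1 = 0) by (rewrite RInt_const; apply Rmult_0_r).
  unfold cesaro, RtoC. f_equal; (etransitivity; [|exact Z]); apply RInt_ext; intros t _; rewrite E; reflexivity.
Qed.

Lemma eqD_of_deriv (f g d : C -> C) : f 0%C = g 0%C ->
  (forall z, inD z -> cderiv f z (d z)) -> (forall z, inD z -> cderiv g z (d z)) -> eqD f g.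
Proof.
  intros E0 Hf Hg z Hz.
  assert (B : Cmod ((fun w => f w - g w) z - (fun w => f w - g w) 0)%C <= 0 * Cmod (z - 0)).
  { apply (mean_value_bound (fun w => f w - g w)%C). intros t Ht.
    assert (Hw : inD (0 + RtoC t * (z - 0))%C).
    { red. apply Rle_lt_trans with (Cmod z); [|exact Hz].
      apply Cmod_segment; auto; [rewrite Cmod_0; apply Cmod_ge_0|lra]. }
    eexists. split; [apply cderiv_minus; [apply Hf, Hw|apply Hg, Hw]|].
    match goal with |- Cmod ?x <= 0 => replace x with (RtoC 0) by ring end. rewrite Cmod_0. lra. }
  cbv beta in B. rewrite E0 in B.
  assert (E : Cmod (f z - g z - (g 0 - g 0)) = 0).
  { apply Rle_antisym; [lra|apply Cmod_ge_0]. }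
  apply Cmod_eq_0 in E. replace (f z) with ((f z - g z - (g 0 - g 0)) + g z)%C by ring.
  rewrite E. ring.
Qed.

Lemma cesaro_deriv_at_0 (beta : R) (f : C -> C) (l : C) : f 0%C = 0%C -> cderiv f 0 l ->
  cesaro_deriv beta f 0 = (l * cesaro_kernel beta 0)%C.
Proof.
  intros H0 Hl. destruct (cesaro_kernel_analytic beta 0 inD_0) as [m Hm].
  apply quot_at_0.
  replace (l * cesaro_kernel beta 0)%C with (l * cesaro_kernel beta 0 + f 0%C * m)%C by (rewrite H0; ring).
  apply cderiv_mult; auto.
Qed.

Lemma cesaro_deriv_off_0 (beta : R) (f : C -> C) (z : C) : z <> 0%C ->
  cesaro_deriv beta f z = (f z * cesaro_kernel beta z / z)%C.
Proof. intros Hz. unfold cesaro_deriv. rewrite quot_off_0 by auto. reflexivity. Qed.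

Lemma cesaro_deriv_lin (beta : R) (f g : C -> C) (c : C) (z : C) :
  analytic_D f -> analytic_D g -> f 0%C = 0%C -> g 0%C = 0%C ->
  cesaro_deriv beta (fun w => f w + c * g w)%C z = (cesaro_deriv beta f z + c * cesaro_deriv beta g z)%C.
Proof.
  intros Hf Hg Hf0 Hg0. destruct (Ceq_dec z 0) as [->|E].
  - destruct (Hf _ inD_0) as [a Ha]. destruct (Hg _ inD_0) as [b Hb].
    rewrite (cesaro_deriv_at_0 beta f a), (cesaro_deriv_at_0 beta g b) by auto.
    rewrite (cesaro_deriv_at_0 beta _ (a + c * b)%C).
    + ring.
    + rewrite Hf0, Hg0. ring.
    + apply cderiv_plus; auto. apply cderiv_scal; auto.
  - rewrite !cesaro_deriv_off_0 by auto. field; auto.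
Qed.

(** Both sides vanish at 0 and have the same derivative, so linearity is inherited from the
    pointwise formula [cesaro_deriv]. The form [f + c g] serves sums with [c = 1] and multiples as
    [f + (c - 1) f]. *)
Lemma cesaro_lin (beta : R) (f g : C -> C) (c : C) :
  analytic_D f -> analytic_D g -> f 0%C = 0%C -> g 0%C = 0%C ->
  eqD (cesaro beta (fun w => f w + c * g w)%C) (fun w => cesaro beta f w + c * cesaro beta g w)%C.
Proof.
  intros Hf Hg Hf0 Hg0.
  apply eqD_of_deriv with (d := cesaro_deriv beta (fun w => f w + c * g w)%C).
  - rewrite !cesaro_at_0. ring.
  - intros z Hz. apply cderiv_cesaro; auto.
    + intros w Hw. destruct (Hf w Hw) as [a Ha]. destruct (Hg w Hw) as [b Hb].
      eexists. apply cderiv_plus; [exact Ha|apply cderiv_scal; exact Hb].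
    + rewrite Hf0, Hg0. ring.
  - intros z Hz. rewrite cesaro_deriv_lin by auto. apply cderiv_plus.
    + apply cderiv_cesaro; auto.
    + apply cderiv_scal, cderiv_cesaro; auto.
Qed.

Lemma cesaro_eqD (beta : R) (f g : C -> C) : eqD f g -> eqD (cesaro beta f) (cesaro beta g).
Proof.
  intros E z Hz. unfold cesaro.
  assert (X : forall t, 0 < t < 1 -> cesaro_integrand beta f z t = cesaro_integrand beta g z t).
  { intros t Ht. unfold cesaro_integrand. rewrite (E (RtoC t * z)%C); [reflexivity|].
    eapply Rle_lt_trans; [apply Cmod_scal_le; lra|exact Hz]. }
  f_equal; apply RInt_ext; rewrite Rmin_left, Rmax_right by lra; intros t Ht; rewrite X; auto.
Qed.

(** The two conditions are one bound [B] on [f(z)/z], with [f'(0)] standing for the quotient at the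
    origin. *)
Lemma Cmod_cesaro_deriv_le (beta : R) (f : C -> C) (z : C) (B : R) : analytic_D f -> f 0%C = 0%C ->
  (z <> 0%C -> Cmod (f z) <= B * Cmod z) ->
  (forall l, z = 0%C -> cderiv f 0 l -> Cmod l <= B) ->
  Cmod (cesaro_deriv beta f z) <= B * Cmod (cesaro_kernel beta z).
Proof.
  intros Hf Hf0 H1 H2. destruct (Ceq_dec z 0) as [->|E].
  - destruct (Hf _ inD_0) as [l Hl]. rewrite (cesaro_deriv_at_0 beta f l), Cmod_mult by auto.
    apply Rmult_le_compat_r; [apply Cmod_ge_0|auto].
  - assert (Hz := proj1 (Cmod_gt_0 z) E).
    rewrite cesaro_deriv_off_0 by auto. rewrite Cmod_div, Cmod_mult by auto.
    apply Rmult_le_reg_r with (Cmod z); auto.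
    replace (Cmod (f z) * Cmod (cesaro_kernel beta z) / Cmod z * Cmod z)
      with (Cmod (f z) * Cmod (cesaro_kernel beta z)) by (field; lra).
    pose proof (Cmod_ge_0 (cesaro_kernel beta z)). specialize (H1 E). nra.
Qed.

(** * Growth of Bloch functions against the weight and the kernel *)

Lemma Rpower_le_1 (x a : R) : 0 < x <= 1 -> 0 <= a -> Rpower x a <= 1.
Proof.
  intros Hx Ha. replace 1 with (Rpower 1 a).
  - apply Rle_Rpower_l; lra.
  - unfold Rpower. rewrite ln_1, Rmult_0_r. apply exp_0.
Qed.

Lemma Rpower_decr_exponent (x a b : R) : 0 < x <= 1 -> a <= b -> Rpower x b <= Rpower x a.
Proof.
  intros Hx Hab. replace b with (a + (b - a)) by ring. rewrite Rpower_plus.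
  rewrite <- (Rmult_1_r (Rpower x a)) at 2. apply Rmult_le_compat_l; [apply Rlt_le, exp_pos|].
  apply Rpower_le_1; lra.
Qed.

(** Uses [1 - |z|^2 <= 2 (1 - |z|)] and [1 - |z| <= |1 - z| <= 2]. The lower bound on [|1 - z|]
    serves for [beta >= 0], the upper one for [beta < 0], hence [Rmax beta 0]; the powers of 2 are
    collected in the constant. *)
Lemma bweight_kernel_le (alpha beta : R) (z : C) : 0 < alpha -> inD z ->
  bweight alpha z * Cmod (cesaro_kernel beta z)
   <= Rpower 2 (alpha + Rabs beta) * Rpower (1 - Cmod z) (alpha - Rmax beta 0).
Proof.
  intros Ha Hz. red in Hz. pose proof (Cmod_ge_0 z) as H0.
  rewrite Cmod_cesaro_kernel. set (x := 1 - Cmod z). assert (Hx : 0 < x <= 1) by (unfold x; lra).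
  assert (B1 : bweight alpha z <= Rpower 2 alpha * Rpower x alpha).
  { rewrite Rpower_mult_distr by lra. apply Rle_Rpower_l; [lra|]. unfold x. split; nra. }
  assert (Hlow : x <= Cmod (1 - z)).
  { pose proof (Cmod_le_sub 1 z) as T. rewrite Cmod_1 in T. unfold x. lra. }
  assert (Hup : Cmod (1 - z) <= 2).
  { unfold Cminus. eapply Rle_trans; [apply Cmod_triangle|]. rewrite Cmod_opp, Cmod_1. lra. }
  assert (B2 : Rpower (Cmod (1 - z)) (- beta) <= Rpower 2 (Rabs beta) * Rpower x (- Rmax beta 0)).
  { destruct (Rle_dec 0 beta) as [Hb|Hb].
    - rewrite Rmax_left, Rabs_pos_eq by lra. rewrite !Rpower_Ropp.
      assert (P1 : 1 <= Rpower 2 beta).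
      { rewrite <- (Rpower_O 2) by lra. apply Rle_Rpower; lra. }
      assert (P2 : / Rpower (Cmod (1 - z)) beta <= / Rpower x beta).
      { apply Rinv_le_contravar; [apply exp_pos|]. apply Rle_Rpower_l; lra. }
      assert (P3 : 0 < / Rpower x beta) by apply Rinv_0_lt_compat, exp_pos. nra.
    - rewrite Rmax_right, Rabs_left by lra. rewrite Ropp_0, Rpower_O, Rmult_1_r by lra.
      apply Rle_Rpower_l; lra. }
  replace (Rpower 2 (alpha + Rabs beta) * Rpower x (alpha - Rmax beta 0))
    with ((Rpower 2 alpha * Rpower x alpha) * (Rpower 2 (Rabs beta) * Rpower x (- Rmax beta 0))).
  - apply Rmult_le_compat; auto; apply Rlt_le, exp_pos.
  - unfold Rminus. rewrite !Rpower_plus. ring.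
Qed.

(* Compares [t |-> f(t z)] with [A rho (1 - rho)^(-s)], [rho = t |z|], whose derivative
   [A (1 - rho)^(-s-1) ((1 - rho) + s rho)] dominates [(1 - rho)^(-s-1)] for [A = 1 / min 1 s]. *)
Lemma bloch_growth (alpha s M : R) (f : C -> C) (z : C) : 0 < alpha -> 0 < s -> alpha <= s + 1 -> 0 <= M ->
  analytic_D f -> f 0%C = 0%C ->
  (forall w l, inD w -> cderiv f w l -> bweight alpha w * Cmod l <= M) -> inD z ->
  Cmod (f z) <= M * / Rmin 1 s * Rpower (1 - Cmod z) (- s) * Cmod z.
Proof.
  intros Ha Hs Has HM Hf Hf0 Hb Hz. red in Hz.
  set (r := Cmod z) in *. assert (Hr0 : 0 <= r) by apply Cmod_ge_0.
  set (A := / Rmin 1 s). assert (Hmin : 0 < Rmin 1 s) by (apply Rmin_pos; lra).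
  assert (HA : 0 < A) by (apply Rinv_0_lt_compat; auto).
  set (psi := fun t => M * A * (t * r) * Rpower (1 - t * r) (- s)).
  set (dpsi := fun t => M * A * r * (Rpower (1 - t * r) (- s) + (t * r) * s * Rpower (1 - t * r) (- s) * / (1 - t * r))).
  assert (B : Cmod (f z - f 0) <= psi 1 - psi 0).
  { apply (mean_value_ineq f 0 z psi dpsi).
    - intros t Ht. assert (0 < 1 - t * r) by nra. unfold psi, dpsi, Rpower. auto_derive; [lra|].
      change (1 + - (t * r)) with (1 - t * r). set (E := exp _). field. lra.
    - intros t Ht. replace (0 + RtoC t * (z - 0))%C with (RtoC t * z)%C by ring.
      replace (z - 0)%C with z by ring. fold r.
      set (w := (RtoC t * z)%C).
      assert (Hw : Cmod w = t * r) by (unfold w; rewrite Cmod_mult, Cmod_R, Rabs_pos_eq by lra; reflexivity).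
      assert (HwD : inD w) by (red; rewrite Hw; nra).
      destruct (Hf w HwD) as [l Hl]. exists l; split; auto. specialize (Hb w l HwD Hl).
      unfold dpsi. set (rho := t * r) in *. assert (Hrho : 0 <= rho < 1) by (unfold rho; nra).
      set (x := 1 - rho). assert (Hx : 0 < x <= 1) by (unfold x; lra).
      (* The base is at most 1, so raising the exponent from [alpha] to [s + 1] lowers the power;
         moreover [1 - rho <= 1 - rho^2]. *)
      assert (Hbw : Rpower x (s + 1) <= bweight alpha w).
      { apply Rle_trans with (Rpower x alpha); [apply Rpower_decr_exponent; lra|].
        unfold bweight. rewrite Hw. apply Rle_Rpower_l; [lra|]. unfold x. split; nra. }
      assert (Hp : 0 < Rpower x (s + 1)) by apply exp_pos.
      assert (Hq : Rpower x (- s) = x * / Rpower x (s + 1)).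
      { assert (0 < Rpower x s) by apply exp_pos.
        rewrite Rpower_Ropp, Rpower_plus, Rpower_1 by lra. field. split; lra. }
      rewrite Hq. pose proof (Cmod_ge_0 l).
      assert (Hl1 : Cmod l <= M * / Rpower x (s + 1)).
      { apply Rmult_le_reg_r with (Rpower x (s + 1)); auto.
        rewrite Rmult_assoc, Rinv_l, Rmult_1_r by lra. nra. }
      replace (M * A * r * (x * / Rpower x (s + 1) + rho * s * (x * / Rpower x (s + 1)) * / x))
        with ((M * / Rpower x (s + 1)) * r * (A * (x + rho * s))) by (field; lra).
      (* As [x + rho = 1], the factor [x + rho * s] is a convex combination of 1 and [s], hence at
         least [Rmin 1 s]. *)
      assert (HA1 : 1 <= A * (x + rho * s)).
      { apply Rmult_le_reg_l with (Rmin 1 s); auto. unfold A.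
        rewrite <- Rmult_assoc, Rinv_r, Rmult_1_l, Rmult_1_r by lra.
        pose proof (Rmin_l 1 s). pose proof (Rmin_r 1 s). unfold x. nra. }
      assert (Cmod l * r <= M * / Rpower x (s + 1) * r) by (apply Rmult_le_compat_r; auto).
      assert (0 <= M * / Rpower x (s + 1) * r).
      { apply Rmult_le_pos; auto. apply Rmult_le_pos; auto. apply Rlt_le, Rinv_0_lt_compat; auto. }
      nra. }
  rewrite Hf0 in B. replace (f z - 0)%C with (f z) in B by ring.
  unfold psi in B. rewrite Rmult_1_l, Rmult_0_l in B. lra.
Qed.

(** * Extraction of subsequences *)

(** Subsequences are handled as infinite sets of indices, so that repeated thinning is mere
    inclusion; an increasing enumeration is made once, in [diagonal_selection]. *)
Definition infinite (A : nat -> Prop) : Prop := forall n, exists m, (n <= m)%nat /\ A m.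

(** Either infinitely many indices of [A] fit the head of the list, or from some [N] on none does,
    and the tail is searched with the indices from [N] on. *)
Lemma infinite_pigeonhole {X : Type} (l : list X) (Q : nat -> X -> Prop) (A : nat -> Prop) :
  infinite A -> (forall n, A n -> exists p, In p l /\ Q n p) ->
  exists p, infinite (fun n => A n /\ Q n p).
Proof.
  revert A. induction l as [|a l IH]; intros A HA H.
  - destruct (HA 0%nat) as [m [_ Hm]]. destruct (H m Hm) as [p [[] _]].
  - destruct (classic (infinite (fun n => A n /\ Q n a))) as [Hi|Hi]; [exists a; exact Hi|].
    apply not_all_ex_not in Hi. destruct Hi as [N HN].
    destruct (IH (fun n => A n /\ (N <= n)%nat)) as [p Hp].
    + intros n. destruct (HA (Nat.max n N)) as [m [Hm1 Hm2]]. exists m. split; [lia|]. split; [auto|lia].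
    + intros n [Hn1 Hn2]. destruct (H n Hn1) as [p [[<-|Hp1] Hp2]]; [|exists p; auto].
      exfalso. apply HN. exists n. auto.
    + exists p. intros n. destruct (Hp n) as [m [Hm1 [[Hm2 _] Hm3]]]. exists m. auto.
Qed.

Lemma interval_net (M eta : R) : 0 < eta -> exists l : list R,
  forall x, Rabs x <= M -> exists p, In p l /\ Rabs (x - p) <= eta.
Proof.
  intros He.
  assert (H : forall N, exists l : list R, forall x, - M <= x <= - M + INR N * eta -> exists p, In p l /\ Rabs (x - p) <= eta).
  { induction N as [|N [l Hl]].
    - exists (- M :: nil). intros x Hx. simpl in Hx. exists (- M). split; [left; auto|].
      replace (x - - M) with 0 by lra. rewrite Rabs_R0. lra.
    - exists ((- M + INR N * eta) :: l). intros x Hx. rewrite S_INR in Hx.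
      destruct (Rle_dec x (- M + INR N * eta)) as [L|L].
      + destruct (Hl x ltac:(lra)) as [p [Hp1 Hp2]]. exists p; split; [right; auto|auto].
      + exists (- M + INR N * eta). split; [left; auto|]. apply Rabs_le. lra. }
  destruct (INR_archimed eta (2 * M) He) as [N HN].
  destruct (H N) as [l Hl]. exists l. intros x Hx. apply Hl. apply Rabs_le_between in Hx. lra.
Qed.

Lemma disc_net (M eta : R) : 0 < eta -> exists l : list C,
  forall z, Cmod z <= M -> exists p, In p l /\ Cmod (z - p) <= eta.
Proof.
  intros He. destruct (interval_net M (eta / 2) ltac:(lra)) as [l Hl].
  exists (list_prod l l). intros z Hz.
  destruct (Hl (fst z)) as [p [Hp1 Hp2]]; [pose proof (re_le_Cmod z) as T; unfold Re in T; lra|].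
  destruct (Hl (snd z)) as [q [Hq1 Hq2]]; [pose proof (Rabs_snd_le_Cmod z); lra|].
  exists (p, q). split; [apply in_prod; auto|].
  eapply Rle_trans; [apply Cmod_le_components|]. simpl. unfold Rminus in *. lra.
Qed.

(** The index set is thinned for one point after another. Values within [eps / 2] of a common net
    point differ by at most [eps]. *)
Lemma finite_points_selection (pts : list C) (v : nat -> C -> C) (M eps : R) (A : nat -> Prop) :
  0 < eps -> infinite A -> (forall n p, A n -> In p pts -> Cmod (v n p) <= M) ->
  exists B : nat -> Prop, infinite B /\ (forall n, B n -> A n) /\
    forall m n p, B m -> B n -> In p pts -> Cmod (v m p - v n p) <= eps.
Proof.
  intros He. revert A. induction pts as [|a pts IH]; intros A HA HM.
  - exists A. split; [auto|split; [auto|]]. intros m n p _ _ [].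
  - destruct (disc_net M (eps / 2) ltac:(lra)) as [l Hl].
    destruct (infinite_pigeonhole l (fun n p => Cmod (v n a - p) <= eps / 2) A HA) as [c Hc].
    { intros n Hn. apply Hl, HM; [auto|left; auto]. }
    destruct (IH _ Hc) as [B [B1 [B2 B3]]].
    { intros n p [Hn _] Hp. apply HM; [auto|right; auto]. }
    exists B. split; [auto|split; [intros n Hn; apply B2, Hn|]].
    intros m n p Hm Hn [<-|Hp]; [|auto].
    eapply Rle_trans; [apply (Cmod_sub_triangle _ c)|].
    destruct (B2 m Hm) as [_ X]. destruct (B2 n Hn) as [_ Y].
    rewrite (Cmod_minus_sym c). lra.
Qed.

(** The Arzela-Ascoli argument at a fixed tolerance: select on a finite net, then reach all points
    through the common Lipschitz constant [L], in thirds of [eps]. The margin [r' - r] leaves room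
    for net points outside the smaller disc. *)
Lemma equicontinuous_selection (v : nat -> C -> C) (A : nat -> Prop) (r r' L eps : R) :
  0 < eps -> r < r' -> 0 <= L -> infinite A ->
  (forall n w, Cmod w <= r' -> exists l, cderiv (v n) w l /\ Cmod l <= L) ->
  (forall n w, Cmod w <= r' -> Cmod (v n w) <= L) ->
  exists B : nat -> Prop, infinite B /\ (forall n, B n -> A n) /\
    forall m n z, B m -> B n -> Cmod z <= r -> Cmod (v m z - v n z) <= eps.
Proof.
  intros He Hr HL HA Hd Hv.
  set (eta := Rmin (r' - r) (eps / (3 * (L + 1)))).
  assert (Heta : 0 < eta) by (apply Rmin_pos; [lra|apply Rdiv_lt_0_compat; lra]).
  assert (Heta1 : eta <= r' - r) by apply Rmin_l.
  assert (Heta2 : L * eta <= eps / 3).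
  { apply Rle_trans with ((L + 1) * (eps / (3 * (L + 1)))).
    - apply Rmult_le_compat; [lra|lra|lra|apply Rmin_r].
    - right. field. lra. }
  destruct (disc_net r eta Heta) as [l Hl].
  (* Net points beyond [r'] get the dummy value 0, so that the bound [L] holds on the whole list;
     they are never the chosen neighbour of a point of the smaller disc. *)
  destruct (finite_points_selection l (fun n p => if Rle_dec (Cmod p) r' then v n p else 0%C) L (eps / 3) A)
    as [B [B1 [B2 B3]]]; [lra|auto| |].
  { intros n p _ _. destruct Rle_dec; [apply Hv; auto|rewrite Cmod_0; auto]. }
  exists B. split; [auto|split; [auto|]]. intros m n z Hm Hn Hz.
  destruct (Hl z Hz) as [p [Hp1 Hp2]].
  assert (Hp : Cmod p <= r').
  { pose proof (Cmod_le_sub p z) as T. rewrite Cmod_minus_sym in T. lra. }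
  specialize (B3 m n p Hm Hn Hp1). cbv beta in B3. destruct Rle_dec as [_|]; [|contradiction].
  assert (Hlip : forall k, Cmod (v k z - v k p) <= eps / 3).
  { intros k. eapply Rle_trans; [apply (mean_value_bound (v k) p z L)|].
    - intros t Ht. apply Hd. apply Cmod_segment; auto. lra.
    - apply Rle_trans with (2 := Heta2). apply Rmult_le_compat_l; auto. }
  pose proof (Hlip m) as Lm. pose proof (Hlip n) as Ln. rewrite Cmod_minus_sym in Ln.
  pose proof (Cmod_sub_triangle (v m z) (v m p) (v n z)).
  pose proof (Cmod_sub_triangle (v m p) (v n p) (v n z)). lra.
Qed.

(** The nested sets [As k] have tolerance [/ INR (S k)], and [phi (S k)] is an element of [As (S k)]
    beyond [phi k]. From rank [N] on, [phi] stays in [As N]. *)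
Lemma diagonal_selection (Q : R -> nat -> nat -> Prop) :
  (forall e1 e2 m n, e1 <= e2 -> Q e1 m n -> Q e2 m n) ->
  (forall eps A, 0 < eps -> infinite A -> exists B : nat -> Prop, infinite B /\
     (forall n, B n -> A n) /\ forall m n, B m -> B n -> Q eps m n) ->
  exists phi : nat -> nat, (forall n, (phi n < phi (S n))%nat) /\
    forall eps, 0 < eps -> exists N, forall m n, (N <= m)%nat -> (N <= n)%nat -> Q eps (phi m) (phi n).
Proof.
  intros Hmon Hsel.
  assert (Hpos : forall k, 0 < / INR (S k)) by (intros k; apply Rinv_0_lt_compat, lt_0_INR; lia).
  pose (refine k (A : {A | infinite A}) :=
    constructive_indefinite_description _ (Hsel (/ INR (S k)) (proj1_sig A) (Hpos k) (proj2_sig A))).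
  pose (next k (A : {A | infinite A}) :=
    exist infinite (proj1_sig (refine k A)) (proj1 (proj2_sig (refine k A)))).
  assert (Hall : infinite (fun _ => True)) by (intros n; exists n; auto).
  pose (As := fix As (k : nat) : {A | infinite A} :=
    match k with O => next 0%nat (exist infinite _ Hall) | S k => next (S k) (As k) end).
  assert (HQ : forall k m n, proj1_sig (As k) m -> proj1_sig (As k) n -> Q (/ INR (S k)) m n).
  { intros k m n. destruct k; apply (proj2 (proj2 (proj2_sig (refine _ _)))). }
  assert (Hsub1 : forall k n, proj1_sig (As (S k)) n -> proj1_sig (As k) n).
  { intros k n. apply (proj1 (proj2 (proj2_sig (refine (S k) (As k))))). }
  assert (Hsub : forall j k n, proj1_sig (As (k + j)%nat) n -> proj1_sig (As k) n).
  { induction j; intros k n; [rewrite Nat.add_0_r; auto|].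
    rewrite Nat.add_succ_r. intros H. apply IHj, Hsub1, H. }
  pose (pick k n := constructive_indefinite_description _ (proj2_sig (As k) n)).
  pose (phi := fix phi (k : nat) : nat := match k with
    | O => proj1_sig (pick 0%nat 0%nat) | S k => proj1_sig (pick (S k) (S (phi k))) end).
  assert (Hphi : forall k, proj1_sig (As k) (phi k)).
  { intros [|k]; [exact (proj2 (proj2_sig (pick 0%nat 0%nat)))|exact (proj2 (proj2_sig (pick (S k) (S (phi k)))))]. }
  exists phi. split.
  - intros n. exact (proj1 (proj2_sig (pick (S n) (S (phi n))))).
  - intros eps He. destruct (INR_archimed eps 1 He) as [N HN].
    exists N. intros m n Hm Hn. apply (Hmon (/ INR (S N))).
    + apply Rmult_le_reg_l with (INR (S N)); [apply lt_0_INR; lia|].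
      rewrite Rinv_r by (apply not_0_INR; lia). rewrite S_INR. lra.
    + apply HQ.
      * apply (Hsub (m - N)%nat N). replace (N + (m - N))%nat with m by lia. apply Hphi.
      * apply (Hsub (n - N)%nat N). replace (N + (n - N))%nat with n by lia. apply Hphi.
Qed.

Lemma C_complete (x : nat -> C) :
  (forall eps, 0 < eps -> exists N, forall m n, (N <= m)%nat -> (N <= n)%nat -> Cmod (x m - x n) <= eps) ->
  exists l, forall eps, 0 < eps -> exists N, forall n, (N <= n)%nat -> Cmod (x n - l) <= eps.
Proof.
  intros H.
  assert (HR : forall y : nat -> R, (forall m n, Rabs (y m - y n) <= Cmod (x m - x n)) ->
    exists l : R, forall eps, 0 < eps -> exists N, forall n, (N <= n)%nat -> Rabs (y n - l) <= eps).
  { intros y Hy. destruct (Rcomplete.R_complete y) as [l Hl].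
    - intros eps He. destruct (H (eps / 2) ltac:(lra)) as [N HN]. exists N. intros m n Hm Hn.
      unfold Rdist. specialize (HN m n Hm Hn). specialize (Hy m n). lra.
    - exists l. intros eps He. destruct (Hl eps He) as [N HN]. exists N. intros n Hn.
      apply Rlt_le. apply (HN n Hn). }
  destruct (HR (fun n => fst (x n))) as [a Ha].
  { intros m n. pose proof (re_le_Cmod (x m - x n)) as T. exact T. }
  destruct (HR (fun n => snd (x n))) as [b Hb].
  { intros m n. pose proof (Rabs_snd_le_Cmod (x m - x n)) as T. exact T. }
  exists (a, b). intros eps He.
  destruct (Ha (eps / 2) ltac:(lra)) as [N1 H1]. destruct (Hb (eps / 2) ltac:(lra)) as [N2 H2].
  exists (Nat.max N1 N2). intros n Hn. eapply Rle_trans; [apply Cmod_le_components|].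
  specialize (H1 n ltac:(lia)). specialize (H2 n ltac:(lia)). simpl. unfold Rminus in *. lra.
Qed.

Lemma Cmod_limit_le (x : nat -> C) (c l : C) (M : R) :
  (forall eps, 0 < eps -> exists N, forall n, (N <= n)%nat -> Cmod (x n - l) <= eps) ->
  (exists N, forall n, (N <= n)%nat -> Cmod (c - x n) <= M) -> Cmod (c - l) <= M.
Proof.
  intros H [N HN]. apply Rle_plus_epsilon. intros eps He. destruct (H eps He) as [N' HN'].
  specialize (HN (Nat.max N N') ltac:(lia)). specialize (HN' (Nat.max N N') ltac:(lia)).
  pose proof (Cmod_sub_triangle c (x (Nat.max N N')) l). lra.
Qed.

(** * Compactness *)

Lemma bweight_lower (alpha r : R) (z : C) : 0 <= alpha -> Cmod z <= r -> r < 1 ->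
  Rpower (1 - r ^ 2) alpha <= bweight alpha z.
Proof.
  intros Ha Hz Hr. pose proof (Cmod_ge_0 z). apply Rle_Rpower_l; [lra|]. split; nra.
Qed.

Lemma cderiv_lin (f g : C -> C) (c z a b : C) : cderiv f z a -> cderiv g z b ->
  cderiv (fun w => f w + c * g w)%C z (a + c * b)%C.
Proof. intros Ha Hb. apply cderiv_plus; [exact Ha|apply cderiv_scal; exact Hb]. Qed.

(** The derivatives [d n] are carried as data, so the Cauchy condition is a pointwise weighted
    inequality. Limits of values and of derivatives are taken separately at each point; what has to
    be shown is that the second is the derivative of the first. *)
Lemma bloch_complete (alpha : R) (v d : nat -> C -> C) : 0 < alpha ->
  (forall n z, inD z -> cderiv (v n) z (d n z)) -> (forall n, v n 0%C = 0%C) ->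
  (forall eps, 0 < eps -> exists N, forall m n, (N <= m)%nat -> (N <= n)%nat ->
     forall z, inD z -> bweight alpha z * Cmod (d m z - d n z) <= eps) ->
  exists g gd : C -> C, (forall z, inD z -> cderiv g z (gd z)) /\ g 0%C = 0%C /\
    forall eps, 0 < eps -> exists N, forall n, (N <= n)%nat ->
      forall z, inD z -> bweight alpha z * Cmod (d n z - gd z) <= eps.
Proof.
  intros Ha Hv Hv0 HC.
  assert (H1 : forall r, 0 <= r < 1 -> forall eps, 0 < eps -> exists N, forall m n, (N <= m)%nat -> (N <= n)%nat ->
     forall z, Cmod z <= r -> Cmod (d m z - d n z) <= eps).
  { intros r Hr eps He. set (c := Rpower (1 - r ^ 2) alpha). assert (Hc : 0 < c) by apply exp_pos.
    destruct (HC (eps * c) (Rmult_lt_0_compat _ _ He Hc)) as [N HN]. exists N. intros m n Hm Hn z Hz.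
    assert (HzD : inD z) by (red; lra).
    specialize (HN m n Hm Hn z HzD). pose proof (bweight_lower alpha r z ltac:(lra) Hz ltac:(lra)) as B. fold c in B.
    pose proof (Cmod_ge_0 (d m z - d n z)). apply Rmult_le_reg_r with c; auto. nra. }
  (* Uniform smallness of the difference quotients of [v m - v n] on a smaller disc, which permits
     exchanging limit and derivative. With [z = 0] it also gives convergence of the values. *)
  assert (H2 : forall r, 0 <= r < 1 -> forall eps, 0 < eps -> exists N, forall m n, (N <= m)%nat -> (N <= n)%nat ->
     forall z w, Cmod z <= r -> Cmod w <= r -> Cmod ((v m w - v m z) - (v n w - v n z)) <= eps * Cmod (w - z)).
  { intros r Hr eps He. destruct (H1 r Hr eps He) as [N HN]. exists N. intros m n Hm Hn z w Hz Hw.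
    replace ((v m w - v m z) - (v n w - v n z))%C with ((v m w - v n w) - (v m z - v n z))%C by ring.
    apply (mean_value_bound (fun x => v m x - v n x)%C). intros t Ht.
    assert (Hx : Cmod (z + RtoC t * (w - z)) <= r) by (apply Cmod_segment; auto).
    assert (HxD : inD (z + RtoC t * (w - z))%C) by (red; lra).
    eexists. split; [apply cderiv_minus; apply Hv; auto|]. apply HN; auto. }
  assert (Hgd : forall z, exists l, inD z -> forall eps, 0 < eps -> exists N, forall n, (N <= n)%nat -> Cmod (d n z - l) <= eps).
  { intros z. destruct (classic (inD z)) as [Hz|Hz]; [|exists 0%C; contradiction].
    destruct (C_complete (fun n => d n z)) as [l Hl]; [|exists l; auto].
    intros eps He. destruct (H1 (Cmod z) (conj (Cmod_ge_0 z) Hz) eps He) as [N HN].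
    exists N. intros m n Hm Hn. apply HN; auto. lra. }
  assert (Hg : forall z, exists l, inD z -> forall eps, 0 < eps -> exists N, forall n, (N <= n)%nat -> Cmod (v n z - l) <= eps).
  { intros z. destruct (classic (inD z)) as [Hz|Hz]; [|exists 0%C; contradiction].
    destruct (C_complete (fun n => v n z)) as [l Hl]; [|exists l; auto].
    intros eps He. destruct (H2 (Cmod z) (conj (Cmod_ge_0 z) Hz) eps He) as [N HN].
    exists N. intros m n Hm Hn. specialize (HN m n Hm Hn 0%C z).
    rewrite !Hv0, Cmod_0 in HN. specialize (HN (Cmod_ge_0 z) (Rle_refl _)).
    replace (v m z - 0 - (v n z - 0))%C with (v m z - v n z)%C in HN by ring.
    replace (z - 0)%C with z in HN by ring. red in Hz.
    pose proof (Cmod_ge_0 z). nra. }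
  pose (gd z := proj1_sig (constructive_indefinite_description _ (Hgd z))).
  pose (g z := proj1_sig (constructive_indefinite_description _ (Hg z))).
  assert (Lgd : forall z, inD z -> forall eps, 0 < eps -> exists N, forall n, (N <= n)%nat -> Cmod (d n z - gd z) <= eps).
  { intros z. exact (proj2_sig (constructive_indefinite_description _ (Hgd z))). }
  assert (Lg : forall z, inD z -> forall eps, 0 < eps -> exists N, forall n, (N <= n)%nat -> Cmod (v n z - g z) <= eps).
  { intros z. exact (proj2_sig (constructive_indefinite_description _ (Hg z))). }
  exists g, gd. split; [|split].
  - intros z Hz. apply cderiv_eps. intros eps He. red in Hz.
    set (r := (1 + Cmod z) / 2). pose proof (Cmod_ge_0 z) as Hz0.
    assert (Hr : 0 <= r < 1) by (unfold r; lra).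
    destruct (H1 r Hr (eps / 3) ltac:(lra)) as [N1 HN1].
    destruct (H2 r Hr (eps / 3) ltac:(lra)) as [N2 HN2].
    set (N := Nat.max N1 N2).
    destruct (proj1 (cderiv_eps _ _ _) (Hv N z Hz) (eps / 3) ltac:(lra)) as [del [Hdel1 Hdel2]].
    exists (Rmin del (r - Cmod z)). split; [apply Rmin_pos; [auto|unfold r; lra]|].
    intros w Hw.
    assert (W1 := Rlt_le_trans _ _ _ Hw (Rmin_l _ _)). assert (W2 := Rlt_le_trans _ _ _ Hw (Rmin_r _ _)).
    assert (Hzr : Cmod z <= r) by (unfold r; lra).
    assert (Hwr : Cmod w <= r) by (pose proof (Cmod_le_sub w z); lra).
    assert (HwD : inD w) by (red; lra).
    specialize (Hdel2 w W1).
    assert (B1 : Cmod (d N z - gd z) <= eps / 3).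
    { apply (Cmod_limit_le (fun n => d n z)); [apply Lgd; exact Hz|].
      exists N. intros n Hn. apply HN1; auto; lia. }
    assert (B2 : Cmod ((v N w - v N z) - (g w - g z)) <= eps / 3 * Cmod (w - z)).
    { apply (Cmod_limit_le (fun n => (v n w - v n z)%C)).
      - intros e He'. destruct (Lg w HwD (e / 2) ltac:(lra)) as [M1 HM1].
        destruct (Lg z Hz (e / 2) ltac:(lra)) as [M2 HM2].
        exists (Nat.max M1 M2). intros n Hn. specialize (HM1 n ltac:(lia)). specialize (HM2 n ltac:(lia)).
        replace (v n w - v n z - (g w - g z))%C with ((v n w - g w) + - (v n z - g z))%C by ring.
        eapply Rle_trans; [apply Cmod_triangle|]. rewrite Cmod_opp. lra.
      - exists N. intros n Hn. apply HN2; auto; lia. }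
    (* Three errors of [eps / 3] each: replacing the increment of [g] by that of [v N],
       differentiating [v N], and replacing [d N z] by [gd z]. *)
    replace (g w - g z - (w - z) * gd z)%C with
      (- ((v N w - v N z) - (g w - g z)) + (v N w - v N z - (w - z) * d N z) + (w - z) * (d N z - gd z))%C by ring.
    eapply Rle_trans; [apply Cmod_triangle|]. rewrite Cmod_mult.
    pose proof (Cmod_triangle (- ((v N w - v N z) - (g w - g z))) (v N w - v N z - (w - z) * d N z)) as T.
    rewrite Cmod_opp in T.
    pose proof (Cmod_ge_0 (w - z)). nra.
  - assert (B : Cmod (0 - g 0) <= 0).
    { apply (Cmod_limit_le (fun n => v n 0%C)); [apply Lg, inD_0|].
      exists 0%nat. intros n _. rewrite Hv0. replace (0 - 0)%C with (RtoC 0) by ring. rewrite Cmod_0. lra. }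
    assert (E : Cmod (0 - g 0) = 0) by (apply Rle_antisym; [auto|apply Cmod_ge_0]).
    apply Cmod_eq_0 in E. replace (g 0%C) with (- (0 - g 0))%C by ring. rewrite E. ring.
  - intros eps He. destruct (HC eps He) as [N HN]. exists N. intros n Hn z Hz.
    pose proof (bweight_pos alpha z) as Hb.
    assert (B : Cmod (d n z - gd z) <= eps / bweight alpha z).
    { apply (Cmod_limit_le (fun n => d n z)); [apply Lgd; exact Hz|].
      exists N. intros m Hm. apply Rmult_le_reg_l with (bweight alpha z); auto.
      replace (bweight alpha z * (eps / bweight alpha z)) with eps by (field; lra). apply HN; auto. }
    apply (Rmult_le_compat_l (bweight alpha z)) in B; [|lra].
    replace (bweight alpha z * (eps / bweight alpha z)) with eps in B by (field; lra). exact B.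
Qed.

Definition kernel_const (alpha beta : R) : R := Rpower 2 (alpha + Rabs beta).

Lemma cesaro_deriv_bound (alpha beta s M : R) (f : C -> C) (z : C) :
  0 < alpha -> 0 < s -> alpha <= s + 1 -> 0 <= M -> analytic_D f -> f 0%C = 0%C ->
  (forall w l, inD w -> cderiv f w l -> bweight alpha w * Cmod l <= M) -> inD z ->
  bweight alpha z * Cmod (cesaro_deriv beta f z)
    <= kernel_const alpha beta * (M * / Rmin 1 s) * Rpower (1 - Cmod z) (alpha - Rmax beta 0 - s).
Proof.
  intros Ha Hs Has HM Hf Hf0 Hb Hz.
  assert (Hmin : 0 < Rmin 1 s) by (apply Rmin_pos; lra).
  (* At [z = 0] the quotient is [f'(0)], of modulus at most [M]; this inequality lets the constant
     of the growth estimate cover it. *)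
  assert (HA : 1 <= / Rmin 1 s).
  { apply Rmult_le_reg_l with (Rmin 1 s); auto. rewrite Rinv_r, Rmult_1_r by lra. apply Rmin_l. }
  set (B := M * / Rmin 1 s * Rpower (1 - Cmod z) (- s)).
  assert (HB : Cmod (cesaro_deriv beta f z) <= B * Cmod (cesaro_kernel beta z)).
  { apply Cmod_cesaro_deriv_le; auto.
    - intros _. apply (bloch_growth alpha s M f z); auto.
    - intros l E Hl. specialize (Hb 0%C l inD_0 Hl). rewrite bweight_0, Rmult_1_l in Hb.
      unfold B. rewrite E, Cmod_0, Rminus_0_r. unfold Rpower. rewrite ln_1, Rmult_0_r, exp_0. nra. }
  assert (HB0 : 0 <= B).
  { unfold B. apply Rmult_le_pos; [nra|apply Rlt_le, exp_pos]. }
  pose proof (bweight_pos alpha z).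
  apply Rle_trans with (bweight alpha z * (B * Cmod (cesaro_kernel beta z))); [apply Rmult_le_compat_l; lra|].
  apply Rle_trans with (B * (kernel_const alpha beta * Rpower (1 - Cmod z) (alpha - Rmax beta 0))).
  - pose proof (bweight_kernel_le alpha beta z Ha Hz) as K. fold (kernel_const alpha beta) in K. nra.
  - right. unfold B. replace (alpha - Rmax beta 0 - s) with (alpha - Rmax beta 0 + - s) by ring.
    rewrite Rpower_plus. ring.
Qed.

(** The disc is cut at radius [r]. Outside, the general bound is evaluated at distance [1 - r] from
    the boundary, whatever the size of [f]; inside, the smallness [delta] of [f] controls
    [f(z)/z]. *)
Lemma cesaro_deriv_small (alpha beta s M r delta : R) (f : C -> C) (z : C) :
  0 < alpha -> 0 < s -> alpha <= s + 1 -> s <= alpha - Rmax beta 0 -> 0 <= M ->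
  analytic_D f -> f 0%C = 0%C ->
  (forall w l, inD w -> cderiv f w l -> bweight alpha w * Cmod l <= M) ->
  3 / 4 <= r < 1 -> (forall w, Cmod w <= r -> Cmod (f w) <= delta) -> inD z ->
  bweight alpha z * Cmod (cesaro_deriv beta f z)
    <= Rmax (kernel_const alpha beta * (8 * delta))
         (kernel_const alpha beta * (M * / Rmin 1 s) * Rpower (1 - r) (alpha - Rmax beta 0 - s)).
Proof.
  intros Ha Hs Has Hsb HM Hf Hf0 Hb Hr Hd Hz.
  assert (Hk : 0 < kernel_const alpha beta) by apply exp_pos.
  assert (Hmin : 0 < / Rmin 1 s) by (apply Rinv_0_lt_compat, Rmin_pos; lra).
  assert (Hdel : 0 <= delta) by (eapply Rle_trans; [apply Cmod_ge_0|apply (Hd 0%C); rewrite Cmod_0; lra]).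
  red in Hz. pose proof (Cmod_ge_0 z) as Hz0.
  destruct (Rle_dec (Cmod z) r) as [L|L].
  - apply Rle_trans with (2 := Rmax_l _ _).
    (* The disc of radius [/2] about such an [a] lies in [|w| < 3/4], hence within radius [r];
       Cauchy's estimate gives [4 * delta / (/2)]. *)
    assert (HC : forall a l, Cmod a <= /4 -> cderiv f a l -> Cmod l <= 8 * delta).
    { intros a l Ha4 Hl. replace (8 * delta) with (4 * delta / (/2)) by field.
      apply (Cauchy_estimate f a l (/2) delta); auto; [lra| |];
        intros w Hw; pose proof (Cmod_le_sub w a); [apply Hf; red; lra|apply Hd; lra]. }
    assert (HB : Cmod (cesaro_deriv beta f z) <= 8 * delta * Cmod (cesaro_kernel beta z)).
    { apply Cmod_cesaro_deriv_le; auto.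
      - intros _. destruct (Rle_dec (Cmod z) (/4)) as [L4|L4].
        + replace (f z) with (f z - f 0)%C by (rewrite Hf0; ring).
          replace (Cmod z) with (Cmod (z - 0)) by (f_equal; ring).
          apply mean_value_bound. intros t Ht.
          replace (0 + RtoC t * (z - 0))%C with (RtoC t * z)%C by ring.
          pose proof (Cmod_scal_le t z Ht).
          destruct (Hf (RtoC t * z)%C) as [l Hl]; [red; lra|]. exists l; split; auto. apply (HC (RtoC t * z)%C l); auto. lra.
        (* Here dividing by [Cmod z > /4] costs at most a factor 4. *)
        + specialize (Hd z L). nra.
      - intros l E Hl. apply (HC 0%C l); auto. rewrite Cmod_0. lra. }
    pose proof (bweight_pos alpha z).
    apply Rle_trans with (bweight alpha z * (8 * delta * Cmod (cesaro_kernel beta z))); [apply Rmult_le_compat_l; lra|].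
    pose proof (bweight_kernel_le alpha beta z Ha Hz) as K. fold (kernel_const alpha beta) in K.
    assert (P : Rpower (1 - Cmod z) (alpha - Rmax beta 0) <= 1) by (apply Rpower_le_1; lra).
    assert (P2 : bweight alpha z * Cmod (cesaro_kernel beta z) <= kernel_const alpha beta) by nra.
    nra.
  - apply Rle_trans with (2 := Rmax_r _ _).
    eapply Rle_trans; [apply (cesaro_deriv_bound alpha beta s M); auto|].
    apply Rmult_le_compat_l.
    + apply Rmult_le_pos; [lra|]. apply Rmult_le_pos; lra.
    + apply Rle_Rpower_l; lra.
Qed.

(** The witness is the midpoint between [Rmax 0 (alpha - 1)] and [alpha - Rmax beta 0]. For
    [alpha <= 1] the lower end is 0, and the gap is open because [beta < alpha]; for [alpha > 1] it
    is [alpha - 1], and the gap is open because [beta < 1]. *)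
Lemma exponent_choice (alpha beta : R) : 0 < alpha ->
  (beta < alpha /\ alpha < 1) \/ (beta < 1 /\ 1 < alpha) \/ (beta < alpha /\ alpha = 1) ->
  exists s, 0 < s /\ alpha <= s + 1 /\ s < alpha - Rmax beta 0.
Proof.
  intros Ha H. exists ((Rmax 0 (alpha - 1) + (alpha - Rmax beta 0)) / 2).
  unfold Rmax; repeat destruct Rle_dec; lra.
Qed.

(** The boundary comes first: [r] is fixed from [eps] alone so that the outer term is small for
    every pair of indices. Only then are indices selected on the disc of radius [r], and
    [cesaro_deriv_small] is applied to differences. *)
Lemma cesaro_deriv_selection (alpha beta s eps : R) (u : nat -> C -> C) (A : nat -> Prop) :
  0 < alpha -> 0 < s -> alpha <= s + 1 -> s < alpha - Rmax beta 0 ->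
  (forall n, in_B0 alpha (u n) /\ bloch_norm alpha (u n) <= 1) -> 0 < eps -> infinite A ->
  exists B : nat -> Prop, infinite B /\ (forall n, B n -> A n) /\
    forall m n, B m -> B n -> forall z, inD z ->
      bweight alpha z * Cmod (cesaro_deriv beta (u m) z - cesaro_deriv beta (u n) z) <= eps.
Proof.
  intros Ha Hs Has Hsb Hu He HA.
  assert (Hu1 : forall n w l, inD w -> cderiv (u n) w l -> bweight alpha w * Cmod l <= 1).
  { intros n w l Hw Hl. destruct (Hu n) as [H1 H2]. pose proof (bloch_norm_ub alpha (u n) w l H1 Hw Hl). lra. }
  assert (Ha_u : forall n, analytic_D (u n)) by (intros n; apply (proj1 (Hu n))).
  assert (H0_u : forall n, u n 0%C = 0%C) by (intros n; apply (proj1 (Hu n))).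
  set (kap := alpha - Rmax beta 0 - s). assert (Hkap : 0 < kap) by (unfold kap; lra).
  set (K := kernel_const alpha beta). assert (HK : 0 < K) by apply exp_pos.
  set (Q := / Rmin 1 s). assert (HQ : 0 < Q) by (apply Rinv_0_lt_compat, Rmin_pos; lra).
  assert (HKQ : 0 < K * (2 * Q)) by (apply Rmult_lt_0_compat; lra).
  (* The 2 is the Bloch bound for a difference of two elements of the unit ball. Then [x = 1 - r]
     satisfies [x^kap <= y], and its cap [/4] ensures [r >= 3/4]. *)
  set (y := eps / (K * (2 * Q))). assert (Hy : 0 < y) by (apply Rdiv_lt_0_compat; auto).
  set (x := Rmin (/4) (Rpower y (/ kap))).
  assert (Hx0 : 0 < x) by (apply Rmin_pos; [lra|apply exp_pos]).
  assert (Hx1 : x <= /4) by apply Rmin_l.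
  set (r := 1 - x).
  assert (Hxk : K * (2 * Q) * Rpower (1 - r) kap <= eps).
  { replace (1 - r) with x by (unfold r; ring).
    assert (P : Rpower x kap <= y).
    { apply Rle_trans with (Rpower (Rpower y (/ kap)) kap).
      - apply Rle_Rpower_l; [lra|]. split; [auto|apply Rmin_r].
      - rewrite Rpower_mult, Rinv_l, Rpower_1 by lra. lra. }
    apply (Rmult_le_compat_l (K * (2 * Q))) in P; [|lra].
    replace (K * (2 * Q) * y) with eps in P by (unfold y; field; lra). exact P. }
  set (r' := (1 + r) / 2). assert (Hr' : r < r' < 1) by (unfold r', r; lra).
  assert (Hr : 3 / 4 <= r < 1) by (unfold r; lra).
  set (c := Rpower (1 - r' ^ 2) alpha). assert (Hc : 0 < c) by apply exp_pos.
  assert (Hder : forall n w, Cmod w <= r' -> exists l, cderiv (u n) w l /\ Cmod l <= / c).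
  { intros n w Hw. assert (HwD : inD w) by (red; lra). destruct (Ha_u n w HwD) as [l Hl]. exists l; split; auto.
    specialize (Hu1 n w l HwD Hl).
    pose proof (bweight_lower alpha r' w ltac:(lra) Hw ltac:(lra)) as B. fold c in B.
    pose proof (Cmod_ge_0 l). apply Rmult_le_reg_l with c; auto. rewrite Rinv_r by lra. nra. }
  assert (Hic : 0 < / c) by (apply Rinv_0_lt_compat; auto).
  (* The tolerance [eps / (8 * K)] turns the inner term [K * (8 * delta)] into exactly [eps]. *)
  destruct (equicontinuous_selection u A r r' (/ c) (eps / (8 * K))) as [B [B1 [B2 B3]]]; auto; try lra.
  { apply Rdiv_lt_0_compat; lra. }
  { intros n w Hw. replace (u n w) with (u n w - u n 0)%C by (rewrite H0_u; ring).
    apply Rle_trans with (/ c * Cmod (w - 0)).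
    - apply mean_value_bound. intros t Ht. apply Hder. apply Cmod_segment; auto. rewrite Cmod_0. lra.
    - replace (w - 0)%C with w by ring. pose proof (Cmod_ge_0 w). nra. }
  exists B. split; [auto|split; [auto|]]. intros m n Hm Hn z Hz.
  set (f := fun w => (u m w + (- (1)) * u n w)%C).
  replace (cesaro_deriv beta (u m) z - cesaro_deriv beta (u n) z)%C with (cesaro_deriv beta f z).
  2:{ unfold f. rewrite cesaro_deriv_lin by auto. ring. }
  assert (Hf : forall w l, inD w -> cderiv f w l -> bweight alpha w * Cmod l <= 2).
  { intros w l Hw Hl. destruct (Ha_u m w Hw) as [a Hla]. destruct (Ha_u n w Hw) as [b Hlb].
    rewrite (cderiv_unique f w l _ Hl (cderiv_lin _ _ _ _ _ _ Hla Hlb)).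
    pose proof (Hu1 m w a Hw Hla). pose proof (Hu1 n w b Hw Hlb).
    pose proof (Cmod_triangle a (- (1) * b)) as T. rewrite Cmod_mult, Cmod_m1 in T.
    pose proof (bweight_pos alpha w). nra. }
  eapply Rle_trans.
  - apply (cesaro_deriv_small alpha beta s 2 r (eps / (8 * K)) f z); auto; try lra.
    + intros w Hw. destruct (Ha_u m w Hw) as [a Hla]. destruct (Ha_u n w Hw) as [b Hlb].
      eexists. exact (cderiv_lin _ _ _ _ _ _ Hla Hlb).
    + unfold f. rewrite !H0_u. ring.
    + intros w Hw. unfold f. replace (u m w + - (1) * u n w)%C with (u m w - u n w)%C by ring. auto.
  - fold K Q kap. apply Rmax_lub; [|exact Hxk]. right. field. lra.
Qed.

(** * Operators on the Bloch space *)

Lemma in_B0_lin (alpha : R) (f g : C -> C) (c : C) : in_B0 alpha f -> in_B0 alpha g ->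
  in_B0 alpha (fun z => f z + c * g z)%C.
Proof.
  intros Hf Hg. assert (Hf' := Hf). assert (Hg' := Hg). destruct Hf' as [Fa [_ F0]]. destruct Hg' as [Ga [_ G0]].
  apply (in_B0_intro alpha _ (bloch_norm alpha f + Cmod c * bloch_norm alpha g)).
  - intros z Hz. destruct (Fa z Hz) as [a Hla]. destruct (Ga z Hz) as [b Hlb].
    eexists. exact (cderiv_lin _ _ _ _ _ _ Hla Hlb).
  - rewrite F0, G0. ring.
  - intros z l Hz Hl. destruct (Fa z Hz) as [a Hla]. destruct (Ga z Hz) as [b Hlb].
    rewrite (cderiv_unique _ z l _ Hl (cderiv_lin f g c z a b Hla Hlb)).
    pose proof (bloch_norm_ub alpha f z a Hf Hz Hla). pose proof (bloch_norm_ub alpha g z b Hg Hz Hlb).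
    pose proof (Cmod_triangle a (c * b)) as T. rewrite Cmod_mult in T.
    pose proof (bweight_pos alpha z). pose proof (Cmod_ge_0 c).
    assert (Cmod c * (bweight alpha z * Cmod b) <= Cmod c * bloch_norm alpha g) by (apply Rmult_le_compat_l; auto).
    nra.
Qed.

Lemma cesaro_bounded_values (alpha beta s : R) (f : C -> C) :
  0 < alpha -> 0 < s -> alpha <= s + 1 -> s < alpha - Rmax beta 0 -> in_B0 alpha f ->
  in_B0 alpha (cesaro beta f) /\
  bloch_norm alpha (cesaro beta f) <= kernel_const alpha beta * / Rmin 1 s * bloch_norm alpha f.
Proof.
  intros Ha Hs Has Hsb Hf. assert (Hf' := Hf). destruct Hf' as [Fa [_ F0]].
  pose proof (bloch_norm_nonneg alpha f Hf) as Hn.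
  assert (Hk : 0 < kernel_const alpha beta) by apply exp_pos.
  assert (Hmin : 0 < / Rmin 1 s) by (apply Rinv_0_lt_compat, Rmin_pos; lra).
  apply in_B0_intro.
  - intros z Hz. exists (cesaro_deriv beta f z). apply cderiv_cesaro; auto.
  - apply cesaro_at_0.
  - intros z l Hz Hl. rewrite (cderiv_unique _ z l _ Hl (cderiv_cesaro beta f z Fa F0 Hz)).
    eapply Rle_trans; [apply (cesaro_deriv_bound alpha beta s (bloch_norm alpha f)); auto|].
    + intros w d Hw Hd. apply bloch_norm_ub; auto.
    + assert (P : Rpower (1 - Cmod z) (alpha - Rmax beta 0 - s) <= 1).
      { red in Hz. pose proof (Cmod_ge_0 z). apply Rpower_le_1; lra. }
      assert (0 <= kernel_const alpha beta * (bloch_norm alpha f * / Rmin 1 s)).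
      { apply Rmult_le_pos; [lra|]. apply Rmult_le_pos; lra. }
      nra.
Qed.

Lemma in_B0_scal (alpha : R) (f : C -> C) (c : C) : in_B0 alpha f ->
  in_B0 alpha (fun z => c * f z)%C /\ bloch_norm alpha (fun z => c * f z)%C <= Cmod c * bloch_norm alpha f.
Proof.
  intros Hf. assert (Hf' := Hf). destruct Hf' as [Fa [_ F0]].
  apply in_B0_intro.
  - intros z Hz. destruct (Fa z Hz) as [a Hla]. eexists. apply cderiv_scal; exact Hla.
  - rewrite F0. ring.
  - intros z l Hz Hl. destruct (Fa z Hz) as [a Hla].
    rewrite (cderiv_unique _ z l _ Hl (cderiv_scal c f z a Hla)), Cmod_mult.
    pose proof (bloch_norm_ub alpha f z a Hf Hz Hla). pose proof (Cmod_ge_0 c).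
    assert (Cmod c * (bweight alpha z * Cmod a) <= Cmod c * bloch_norm alpha f) by (apply Rmult_le_compat_l; auto).
    lra.
Qed.

Lemma in_B0_minus (alpha : R) (f g : C -> C) : in_B0 alpha f -> in_B0 alpha g ->
  in_B0 alpha (fun z => f z - g z)%C.
Proof.
  intros Hf Hg. replace (fun z => f z - g z)%C with (fun z => f z + (- (1)) * g z)%C.
  - apply in_B0_lin; auto.
  - apply functional_extensionality; intros z; ring.
Qed.

Lemma bounded_op_scal (alpha : R) (T : op) (c : C) : is_bounded_op alpha T ->
  is_bounded_op alpha (fun f z => c * T f z)%C.
Proof.
  intros [[T1 [T2 [T3 T4]]] [M HM]]. split; [split; [|split; [|split]]|].
  - intros f Hf. apply in_B0_scal, T1, Hf.
  - intros f g Hf Hg E z Hz. rewrite (T2 f g Hf Hg E z Hz). reflexivity.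
  - intros f g Hf Hg z Hz. rewrite (T3 f g Hf Hg z Hz). ring.
  - intros k f Hf z Hz. rewrite (T4 k f Hf z Hz). ring.
  - exists (Cmod c * M). intros f Hf.
    eapply Rle_trans; [apply in_B0_scal, T1, Hf|]. rewrite Rmult_assoc.
    apply Rmult_le_compat_l; [apply Cmod_ge_0|auto].
Qed.

(** Serves for [c = -1], to make the perturbation that cancels a compact operator. *)
Lemma compact_op_scal (alpha : R) (T : op) (c : C) : is_compact_op alpha T ->
  is_compact_op alpha (fun f z => c * T f z)%C.
Proof.
  intros [Hb Hc]. split; [apply bounded_op_scal; exact Hb|].
  intros u Hu. destruct (Hc u Hu) as [phi [g [H1 [H2 H3]]]].
  exists phi, (fun z => c * g z)%C. split; [auto|split; [apply in_B0_scal; auto|]].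
  assert (Hd : forall n, in_B0 alpha (fun z => T (u (phi n)) z - g z)%C).
  { intros n. apply in_B0_minus; [|auto]. apply Hb, Hu. }
  apply (is_lim_seq_le_le (fun _ => 0) _ (fun n => Cmod c * bloch_norm alpha (fun z => T (u (phi n)) z - g z)%C)).
  - intros n. replace (fun z => c * T (u (phi n)) z - c * g z)%C with (fun z => c * (T (u (phi n)) z - g z))%C
      by (apply functional_extensionality; intros z; ring).
    split; [apply bloch_norm_nonneg|]; apply in_B0_scal, Hd.
  - apply is_lim_seq_const.
  - replace (Finite 0) with (Rbar_mult (Cmod c) 0) by (simpl; f_equal; ring).
    apply is_lim_seq_scal_l, H3.
Qed.

Lemma cesaro_bounded (alpha beta s : R) :
  0 < alpha -> 0 < s -> alpha <= s + 1 -> s < alpha - Rmax beta 0 -> is_bounded_op alpha (cesaro beta).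
Proof.
  intros Ha Hs Has Hsb. split; [split; [|split; [|split]]|].
  - intros f Hf. apply (cesaro_bounded_values alpha beta s f); auto.
  - intros f g _ _ E. apply cesaro_eqD, E.
  - intros f g [Fa [_ F0]] [Ga [_ G0]] z Hz.
    replace (fun z => f z + g z)%C with (fun z => f z + 1 * g z)%C by (apply functional_extensionality; intros w; ring).
    rewrite (cesaro_lin beta f g 1 Fa Ga F0 G0 z Hz). ring.
  - intros c f [Fa [_ F0]] z Hz.
    replace (fun z => c * f z)%C with (fun z => f z + (c - 1) * f z)%C by (apply functional_extensionality; intros w; ring).
    rewrite (cesaro_lin beta f f (c - 1) Fa Fa F0 F0 z Hz). ring.
  - exists (kernel_const alpha beta * / Rmin 1 s). intros f Hf. apply cesaro_bounded_values; auto.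
Qed.

Lemma cesaro_compact (alpha beta s : R) :
  0 < alpha -> 0 < s -> alpha <= s + 1 -> s < alpha - Rmax beta 0 -> is_compact_op alpha (cesaro beta).
Proof.
  intros Ha Hs Has Hsb. split; [apply (cesaro_bounded alpha beta s); auto|].
  intros u Hu.
  assert (Fa : forall n, analytic_D (u n)) by (intros n; apply (proj1 (Hu n))).
  assert (F0 : forall n, u n 0%C = 0%C) by (intros n; apply (proj1 (Hu n))).
  destruct (diagonal_selection (fun eps m n => forall z, inD z ->
      bweight alpha z * Cmod (cesaro_deriv beta (u m) z - cesaro_deriv beta (u n) z) <= eps)) as [phi [Hphi HC]].
  { intros e1 e2 m n He H z Hz. apply Rle_trans with (2 := He). auto. }
  { intros eps A He HA. apply (cesaro_deriv_selection alpha beta s); auto. }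
  destruct (bloch_complete alpha (fun n => cesaro beta (u (phi n))) (fun n => cesaro_deriv beta (u (phi n))))
    as [g [gd [Hg [Hg0 Hlim]]]]; auto.
  { intros n z Hz. apply cderiv_cesaro; auto. }
  { intros n. apply cesaro_at_0. }
  assert (HT : forall n, in_B0 alpha (cesaro beta (u n))).
  { intros n. apply (cesaro_bounded_values alpha beta s (u n)); auto. apply Hu. }
  assert (HgB : in_B0 alpha g).
  (* One image at distance at most 1 from the limit already bounds the norm of [g]. *)
  { destruct (Hlim 1 ltac:(lra)) as [N HN]. specialize (HN N (le_n _)).
    apply (in_B0_intro alpha g (bloch_norm alpha (cesaro beta (u (phi N))) + 1)).
    - intros z Hz. exists (gd z). auto.
    - exact Hg0.
    - intros z l Hz Hl. rewrite (cderiv_unique g z l _ Hl (Hg z Hz)). specialize (HN z Hz).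
      pose proof (bloch_norm_ub alpha _ z _ (HT (phi N)) Hz (cderiv_cesaro beta (u (phi N)) z (Fa _) (F0 _) Hz)) as B.
      pose proof (Cmod_le_sub (gd z) (cesaro_deriv beta (u (phi N)) z)) as T. rewrite (Cmod_minus_sym (gd z)) in T.
      pose proof (bweight_pos alpha z). nra. }
  exists phi, g. split; [auto|split; [auto|]].
  apply is_lim_seq_spec. intros eps.
  destruct (Hlim (eps / 2)) as [N HN]; [pose proof (cond_pos eps); lra|].
  exists N. intros n Hn. rewrite Rminus_0_r.
  pose proof (in_B0_minus alpha _ _ (HT (phi n)) HgB) as HD.
  rewrite Rabs_pos_eq by (apply bloch_norm_nonneg, HD).
  apply Rle_lt_trans with (eps / 2); [|pose proof (cond_pos eps); lra].
  apply (in_B0_intro alpha); try apply HD.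
  intros z l Hz Hl.
  rewrite (cderiv_unique _ z l _ Hl (cderiv_minus _ _ _ _ _ (cderiv_cesaro beta (u (phi n)) z (Fa _) (F0 _) Hz) (Hg z Hz))).
  apply HN; auto.
Qed.

Lemma in_B0_zero (alpha : R) : in_B0 alpha (fun _ => 0%C) /\ bloch_norm alpha (fun _ => 0%C) <= 0.
Proof.
  apply in_B0_intro; auto.
  - intros z _. eexists. apply cderiv_const.
  - intros z l _ Hl. rewrite (cderiv_unique _ z l _ Hl (cderiv_const 0 z)), Cmod_0. lra.
Qed.

(** Every competing operator norm is at least the norm of the image of the zero function, hence
    nonnegative; the competitor [-T] attains 0. *)
Lemma ess_norm_compact (alpha : R) (T : op) : is_compact_op alpha T -> ess_norm alpha T = Finite 0.
Proof.
  intros HT. destruct (in_B0_zero alpha) as [Z1 Z2].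
  assert (Z3 : bloch_norm alpha (fun _ => 0%C) = 0).
  { apply Rle_antisym; [auto|apply bloch_norm_nonneg; auto]. }
  apply is_glb_Rbar_unique. split.
  - intros r [K [HK E]].
    destruct (Lub_Rbar_correct (fun r => exists f, in_B0 alpha f /\ bloch_norm alpha f <= 1 /\
       r = bloch_norm alpha (op_plus T K f))) as [Hub _].
    fold (op_norm alpha (op_plus T K)) in Hub. rewrite E in Hub.
    eapply Rbar_le_trans; [|apply Hub; exists (fun _ => 0%C); split; [auto|split; [lra|reflexivity]]].
    apply bloch_norm_nonneg.
    replace (op_plus T K (fun _ => 0%C)) with (fun z => T (fun _ => 0%C) z + 1 * K (fun _ => 0%C) z)%C
      by (apply functional_extensionality; intros z; unfold op_plus; ring).
    apply in_B0_lin; [apply HT|apply HK]; auto.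
  - intros b Hb. apply Hb. exists (fun f z => (- (1)) * T f z)%C. split; [apply compact_op_scal, HT|].
    (* The cancellation holds at every complex number, also outside the disc, so the sum is
       literally the zero function and not merely equal to it under [eqD]. *)
    assert (E : forall f, op_plus T (fun f z => (- (1)) * T f z)%C f = (fun _ => 0%C)).
    { intros f. apply functional_extensionality; intros z. unfold op_plus. ring. }
    apply is_lub_Rbar_unique. split.
    + intros r [f [_ [_ ->]]]. rewrite E, Z3. apply Rle_refl.
    + intros c Hc. apply Hc. exists (fun _ => 0%C). rewrite E, Z3. repeat split; auto; try apply Z1. lra.
Qed.

(** Boundedness is asserted as well, since the essential norm is a notion for bounded operators from
    the space to itself. *)
Theorem theorem4p3 (alpha beta : R) (Halpha : 0 < alpha)
  (Hab : (beta < alpha /\ alpha < 1) \/ (beta < 1 /\ 1 < alpha) \/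
         (beta < alpha /\ alpha = 1)) :
  is_bounded_op alpha (cesaro beta) /\ ess_norm alpha (cesaro beta) = Finite 0.
Proof.
  destruct (exponent_choice alpha beta Halpha Hab) as [s [Hs [Has Hsb]]].
  pose proof (cesaro_compact alpha beta s Halpha Hs Has Hsb) as HT.
  split; [exact (proj1 HT)|exact (ess_norm_compact alpha _ HT)].
Qed.
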